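(* Let $$F(t,s,r;u)=\sum_{n\ge0}\Bigl(\sum_{\pi\in\mathfrak{S}_n}t^{\mathrm{des}(\pi)}s^{\mathrm{xdes}(\pi)}r^{\mathrm{fix}(\pi)}\Bigr)\frac{u^n}{(1-t)^{n+1}},$$ and for each $m\ge0$ let $$S_m(u)=\frac{\displaystyle\frac{\prod_{1\le j\le m}(1-uX_j)}{\prod_{0\le j\le m}(1-ruZ_j)}}{\displaystyle 1-\sum_{1\le l\le m}\frac{uX_l\prod_{1\le j\le l-1}(1-uX_j)}{\prod_{0\le j\le l-1}(1-uY_j)}},$$ expanded as a formal power series in $u$ (the coefficient of each $u^n$ is a polynomial in finitely many of the variables $X_j,Y_j,Z_j$ with coefficients in $\mathbb{Z}[r]$). Then, as formal power series in $t$ and $u$, $$F(t,s,r;u)=\sum_{m\ge0}t^m\rho(S_m(u)),$$ where $\rho$ is applied coefficientwise in $u$.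
   Context: $\mathfrak{S}_n$ is the set of permutations of $[n]$. For $\pi\in\mathfrak{S}_n$: $\mathrm{des}(\pi)=|\{i:\pi_i>\pi_{i+1}\}|$; $\mathrm{fix}(\pi)=|\{i:\pi_i=i\}|$; an index $i$ is a crossing descent if $\pi_i\ge i+1\ge\pi_{i+1}$, and $\mathrm{xdes}(\pi)$ is their number. Let $X_0,X_1,\dots,Y_0,Y_1,\dots,Z_0,Z_1,\dots$ be commuting variables. For a monomial $M$ in these variables, an index $i\ge0$ is effective in $M$ if (i) $M$ contains $Y_i$ or $Z_i$, and (ii) $M$ contains some $X_k$ with $k>i$ such that (iii) $M$ contains neither $Y_j$ nor $Z_j$ for every $j$ with $i<j<k$. Let $\mathrm{eff}(M)$ be the number of effective indices of $M$. The linear operator $\rho$ sends $cM$ (with $c$ a scalar coefficient in $\mathbb{Z}[[s,r,u]]$) to $c\,s^{\mathrm{eff}(M)}$, extended linearly to formal power series. For example $\rho(X_1X_2Y_0Y_3Z_0Z_1)=s^2$ and $\rho(X_3X_4Y_1Z_0^2)=s$. *)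

(* Defs.v *)
From HB Require Import structures.
From mathcomp Require Import all_boot all_order all_algebra all_fingroup.
From mathcomp Require Import mpoly.
Set Implicit Arguments. Unset Strict Implicit. Unset Printing Implicit Defensive.
Import GRing.Theory.
Local Open Scope ring_scope.

Definition fps (R : Type) := nat -> R.

Section FPS.
Variable R : comRingType.
Definition fps_const (c : R) : fps R := fun n => if n == 0%N then c else 0.
Definition fps_one : fps R := fps_const 1.
Definition fps_X : fps R := fun n => if n == 1%N then 1 else 0.
Definition fps_add (f g : fps R) : fps R := fun n => f n + g n.
Definition fps_sub (f g : fps R) : fps R := fun n => f n - g n.
Definition fps_mul (f g : fps R) : fps R :=
  fun n => \sum_(i < n.+1) f i * g (n - i)%N.
Definition fps_pow (f : fps R) (k : nat) : fps R := iter k (fps_mul f) fps_one.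
(* Multiplicative inverse of a series f with constant term 1:
   1/f = 1/(1 - (1 - f)) = sum_k (1 - f)^k, where (1 - f)^k has order >= k,
   so the coefficient of u^n only involves k <= n. *)
Definition fps_inv (f : fps R) : fps R :=
  fun n => \sum_(k < n.+1) fps_pow (fps_sub fps_one f) k n.
Definition fps_lin (a : R) : fps R := fps_sub fps_one (fps_mul (fps_const a) fps_X).
End FPS.

Definition Zsr := {mpoly int[2]}.
Definition var_s : Zsr := 'X_(@Ordinal 2 0 isT).
Definition var_r : Zsr := 'X_(@Ordinal 2 1 isT).

(* Permutation statistics (positions and values 0-based; these         *)
(* statistics are invariant under the shift 1..n -> 0..n-1)            *)
Definition des n (p : 'S_n) : nat :=
  #|[pred ij : 'I_n * 'I_n | (val ij.2 == (val ij.1).+1) && (p ij.2 < p ij.1)%N]|.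
(* 1-based: pi_i >= i+1 >= pi_{i+1}; 0-based (v = value-1, q = pos-1):
   p q >= q+1 >= p (q+1). *)
Definition xdes n (p : 'S_n) : nat :=
  #|[pred ij : 'I_n * 'I_n | (val ij.2 == (val ij.1).+1) &&
        ((val ij.1).+1 <= p ij.1)%N && (p ij.2 <= (val ij.1).+1)%N]|.
Definition fixp n (p : 'S_n) : nat := #|[pred i : 'I_n | p i == i]|.

Definition Apoly (n : nat) : fps Zsr :=
  fun k => \sum_(p : 'S_n | des p == k) var_s ^+ xdes p * var_r ^+ fixp p.

(* F(t,s,r;u): Fser n m = coefficient of u^n t^m
   = [t^m] A_n(t) / (1-t)^(n+1). *)
Definition Fser (n m : nat) : Zsr :=
  fps_mul (Apoly n) (fps_inv (fps_pow (fps_lin 1) n.+1)) m.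

(* The variables X_j, Y_j, Z_j (0 <= j <= m) for fixed m, as the       *)
(* 3(m+1) variables of a multivariate polynomial ring over Z[s,r]:     *)
(* X_j -> index j, Y_j -> index m+1+j, Z_j -> index 2(m+1)+j.          *)
Definition nvar (m : nat) : nat := (3 * m + 2).+1.
Definition Rm (m : nat) := {mpoly Zsr[nvar m]}.
Definition Xidx (m j : nat) : nat := j.
Definition Yidx (m j : nat) : nat := (m.+1 + j)%N.
Definition Zidx (m j : nat) : nat := (2 * m.+1 + j)%N.
Definition Xv (m j : nat) : Rm m := 'X_(inord (Xidx m j)).
Definition Yv (m j : nat) : Rm m := 'X_(inord (Yidx m j)).
Definition Zv (m j : nat) : Rm m := 'X_(inord (Zidx m j)).

Definition mexp (m : nat) (M : 'X_{1..nvar m}) (k : nat) : nat :=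
  M (inord k : 'I_(nvar m)).
Definition hasX m (M : 'X_{1..nvar m}) (k : nat) : bool := (0 < mexp M (Xidx m k))%N.
Definition hasYZ m (M : 'X_{1..nvar m}) (j : nat) : bool :=
  (0 < mexp M (Yidx m j))%N || (0 < mexp M (Zidx m j))%N.

(* i is effective in M: M contains Y_i or Z_i, and some X_k with k > i such
   that M contains no Y_j, Z_j for i < j < k.  All variables of Rm m have
   indices <= m, so it suffices to let i, j, k range over 0..m. *)
Definition effective m (M : 'X_{1..nvar m}) (i : nat) : bool :=
  hasYZ M i &&
  has (fun k => (i < k)%N && hasX M k &&
                all (fun j => ~~ hasYZ M j) (iota i.+1 (k - i.+1)))
      (iota 0 m.+1).
Definition eff m (M : 'X_{1..nvar m}) : nat := count (effective M) (iota 0 m.+1).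

Definition rho m (p : Rm m) : Zsr :=
  \sum_(M <- msupp p) p@_M * var_s ^+ eff M.

Definition fps_prod (R : comRingType) (a b : nat) (F : nat -> fps R) : fps R :=
  \big[@fps_mul R/fps_one R]_(a <= j < b) F j.
Definition fps_sum (R : comRingType) (a b : nat) (F : nat -> fps R) : fps R :=
  \big[@fps_add R/fps_const 0]_(a <= j < b) F j.

Definition Sm (m : nat) : fps (Rm m) :=
  let num := fps_prod 1 m.+1 (fun j => fps_lin (Xv m j)) in
  let den := fps_prod 0 m.+1 (fun j => fps_lin ((var_r)%:MP * Zv m j)) in
  let Q := fps_sum 1 m.+1 (fun l =>
             fps_mul (fps_mul (fps_mul (fps_const (Xv m l)) (fps_X _))
                              (fps_prod 1 l (fun j => fps_lin (Xv m j))))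
                     (fps_inv (fps_prod 0 l (fun j => fps_lin (Yv m j))))) in
  fps_mul (fps_mul num (fps_inv den)) (fps_inv (fps_sub (fps_one _) Q)).

(* sum_m t^m rho(S_m(u)): coefficient of u^n t^m *)
Definition RHSser (n m : nat) : Zsr := rho (Sm m n).

(* Main.v *)
Require Import Defs.
From mathcomp Require Import all_boot all_algebra.
From HB Require Import structures.
From mathcomp Require Import all_fingroup boolp mpoly ring zify.
Set Implicit Arguments. Unset Strict Implicit. Unset Printing Implicit Defensive.
Import GRing.Theory.
Local Open Scope ring_scope.

(** The coefficient of [t^m u^n] in [F] counts the pairs [(s, c)] where [c] is a
    weakly decreasing sequence of [n] colours in [0..m], strictly decreasing at
    the descents of [s]; there are [binomial (m + n - des s) n] of them for each
    [s].  Weight [i] by [X], [Z] or [Y] with index [c i] according as [s i > i],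
    [s i = i] or [s i < i].  Inside a colour class [s] increases, so the [Y]'s
    and [Z]'s precede the [X]'s, and a crossing descent is an [X] followed by the
    first [Y] or [Z] of a later class: its number is [eff] of the monomial.

    It remains to see that the weights add up to [S_m].  Refine colours into
    letters (colour, kind).  A pair is then a word [v], an arbitrary
    rearrangement of the refined colour sequence [c], and having the prescribed
    kinds is a local condition on the columns [(c p, v p)], up to one forbidden
    loop at an end of each block, which costs a factor [1 - u w].  The remaining
    sum is evaluated as in MacMahon's master theorem: reading the rows of the
    two-row array as stacks and following letters gives a walk, hence a linear
    system whose matrix depends only on the column and on the side of the
    diagonal, and which is solved explicitly by eliminating one letter at a
    time. *)

(** * The ring of formal power series *)

Section FpsRing.
Variable R : comNzRingType.
Implicit Types f g h : fps R.

Definition fps_trunc N f : {poly R} := \poly_(i < N) f i.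

(** Coefficients below [N] depend only on truncations, so the ring laws are inherited from
    [{poly R}]. *)
Lemma fps_mul_trunc N f g n :
  (n < N)%N -> fps_mul f g n = (fps_trunc N f * fps_trunc N g)`_n.
Proof.
move=> ltnN; rewrite coefM; apply: eq_bigr => i _; rewrite !coef_poly.
by rewrite (leq_ltn_trans _ ltnN) ?leq_ord // (leq_ltn_trans (leq_subr _ _) ltnN).
Qed.

Lemma fps_mulC f g : fps_mul f g = fps_mul g f.
Proof.
by apply/funext => n; rewrite !(@fps_mul_trunc n.+1) // mulrC.
Qed.

Lemma fps_mulA f g h : fps_mul f (fps_mul g h) = fps_mul (fps_mul f g) h.
Proof.
(* The truncation of a product is not the product of the truncations; [mulE] only asks for a
   polynomial agreeing with the series up to degree [n]. *)
have mulE (f1 : fps R) (f2 : {poly R}) h1 n : (forall i, (i < n.+1)%N -> f1 i = f2`_i) ->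
    fps_mul f1 h1 n = (f2 * fps_trunc n.+1 h1)`_n.
  move=> eqf; rewrite coefM; apply: eq_bigr => i _.
  by rewrite eqf // coef_poly ltnS leq_subr.
apply/funext => n; rewrite fps_mulC.
rewrite (mulE _ (fps_trunc n.+1 g * fps_trunc n.+1 h)); last first.
  by move=> i lti; rewrite (fps_mul_trunc _ _ lti).
rewrite (mulE _ (fps_trunc n.+1 f * fps_trunc n.+1 g)); last first.
  by move=> i lti; rewrite (fps_mul_trunc _ _ lti).
by rewrite mulrC mulrA.
Qed.

Lemma fps_mulDl f g h :
  fps_mul (fps_add f g) h = fps_add (fps_mul f h) (fps_mul g h).
Proof.
apply/funext => n; rewrite /fps_add /fps_mul -big_split /=.
by apply: eq_bigr => i _; rewrite mulrDl.
Qed.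

Lemma fps_const_mulE c f n : fps_mul (fps_const c) f n = c * f n.
Proof.
rewrite /fps_mul big_ord_recl /= subn0 /fps_const eqxx big1 ?addr0 // => i _.
by rewrite mul0r.
Qed.

Lemma fps_mul1 f : fps_mul (fps_one R) f = f.
Proof. by apply/funext => n; rewrite fps_const_mulE mul1r. Qed.

End FpsRing.

HB.instance Definition _ (R : comNzRingType) := gen_eqMixin (fps R).
HB.instance Definition _ (R : comNzRingType) := gen_choiceMixin (fps R).

Section FpsInstance.
Variable R : comNzRingType.

Definition fps_opp (f : fps R) : fps R := fun n => - f n.

Fact fps_addA : associative (@fps_add R).
Proof. by move=> f g h; apply/funext => n; rewrite /fps_add addrA. Qed.
Fact fps_addC : commutative (@fps_add R).
Proof. by move=> f g; apply/funext => n; rewrite /fps_add addrC. Qed.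
Fact fps_add0 : left_id (@fps_const R 0) (@fps_add R).
Proof.
by move=> f; apply/funext => n; rewrite /fps_add /fps_const if_same add0r.
Qed.
Fact fps_addN : left_inverse (@fps_const R 0) fps_opp (@fps_add R).
Proof.
by move=> f; apply/funext => n; rewrite /fps_add /fps_const if_same addNr.
Qed.
HB.instance Definition _ :=
  GRing.isZmodule.Build (fps R) fps_addA fps_addC fps_add0 fps_addN.

Fact fps_one_neq0 : fps_one R != 0 :> fps R.
Proof.
by apply/eqP => /(congr1 (fun f : fps R => f 0%N)) /eqP; rewrite oner_eq0.
Qed.
HB.instance Definition _ := GRing.Zmodule_isComNzRing.Build (fps R)
  (@fps_mulA R) (@fps_mulC R) (@fps_mul1 R) (@fps_mulDl R) fps_one_neq0.

Implicit Types f g : fps R.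

Lemma fps_oneE : fps_one R = 1. Proof. by []. Qed.
Lemma fps_powE f k : fps_pow f k = f ^+ k.
Proof. by elim: k => // k IHk; rewrite exprS -IHk. Qed.

Lemma coef_fpsD f g n : (f + g) n = f n + g n. Proof. by []. Qed.
Lemma coef_fpsN f n : (- f) n = - f n. Proof. by []. Qed.
Lemma coef_fps1 n : (1 : fps R) n = (n == 0%N)%:R.
Proof. by rewrite -fps_oneE /fps_one /fps_const; case: eqP. Qed.
Lemma coef_fps0 n : (0 : fps R) n = 0.
Proof. exact: (if_same (n == 0%N) 0). Qed.
Lemma coef_fpsM f g n : (f * g) n = \sum_(i < n.+1) f i * g (n - i)%N.
Proof. by []. Qed.
Lemma coef_fps_sum (I : Type) (s : seq I) (P : pred I) (F : I -> fps R) n :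
  (\sum_(i <- s | P i) F i) n = \sum_(i <- s | P i) F i n.
Proof.
by apply: (big_morph (fun f : fps R => f n)) => //; exact: coef_fps0.
Qed.

Definition fps_mono (a : R) : fps R := fps_const a * fps_X R.

Lemma coef_fps_const_mul a f n : (fps_const a * f) n = a * f n.
Proof. exact: fps_const_mulE. Qed.
Lemma coef_mono_mul0 a f : (fps_mono a * f) 0%N = 0.
Proof.
by rewrite /fps_mono -mulrA coef_fps_const_mul coef_fpsM big_ord1 mul0r mulr0.
Qed.
Lemma coef_mono_mulS a f n : (fps_mono a * f) n.+1 = a * f n.
Proof.
rewrite /fps_mono -mulrA coef_fps_const_mul; congr (_ * _).
rewrite coef_fpsM big_ord_recl mul0r add0r big_ord_recl /= subn1 mul1r.
by rewrite big1 ?addr0 // => i _; rewrite mul0r.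
Qed.

Lemma fps_linE (a : R) : fps_lin a = 1 - fps_mono a. Proof. by []. Qed.

Lemma fps_mulr0 f g : (f * g) 0%N = f 0%N * g 0%N.
Proof. by rewrite coef_fpsM big_ord_recl big_ord0 addr0. Qed.

Lemma fps_lin0 (a : R) : fps_lin a 0%N = 1.
Proof. by rewrite fps_linE coef_fpsD coef_fpsN -[fps_mono a]mulr1 coef_mono_mul0 subr0. Qed.

Lemma fps_prod0 (I : Type) (s : seq I) (F : I -> fps R) :
  (forall i, F i 0%N = 1) -> (\prod_(i <- s) F i) 0%N = 1.
Proof.
move=> F1; apply: (big_ind (fun f : fps R => f 0%N = 1)) => // f g f1 g1.
by rewrite fps_mulr0 f1 g1 mulr1.
Qed.

Lemma fps_exp_low f k n : f 0%N = 0 -> (n < k)%N -> (f ^+ k) n = 0.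
Proof.
move=> f0; elim: k n => // k IHk n lt_nk; rewrite exprS coef_fpsM big1 // => i _.
case: (posnP i) => [->|i_gt0]; first by rewrite f0 mul0r.
rewrite IHk ?mulr0 //; move: lt_nk i_gt0 (ltn_ord i); rewrite !ltnS => le_nk i_gt0 le_in.
by rewrite ltn_subLR //; apply: leq_ltn_trans le_nk _; rewrite -addn1 addnC leq_add2r.
Qed.

Lemma fps_mulV f : f 0%N = 1 -> f * fps_inv f = 1.
Proof.
move=> f1; set g := 1 - f; have g0 : g 0%N = 0 by rewrite /g coef_fpsD coef_fpsN f1 subrr.
(* The geometric sum may be cut at any [N > i]: powers of [g] beyond the [i]-th have no term of
   degree [i]. *)
have invE N i : (i < N)%N -> fps_inv f i = (\sum_(k < N) g ^+ k) i.
  move=> lt_iN; rewrite coef_fps_sum /fps_inv.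
  under eq_bigr => k _ do rewrite fps_powE.
  rewrite (big_ord_widen N (fun k => (g ^+ k) i)) // big_mkcond /=.
  apply: eq_bigr => k _; case: ifP => // /negbT; rewrite -leqNgt => lt_ik.
  by rewrite fps_exp_low.
apply/funext => n.
have -> : (f * fps_inv f) n = (f * \sum_(k < n.+1) g ^+ k) n.
  by rewrite !coef_fpsM; apply: eq_bigr => i _; rewrite (invE n.+1) // ltnS leq_subr.
have -> : f = 1 - g by rewrite /g opprB addrC subrK.
rewrite -opprB mulNr -subrX1 opprB.
by rewrite coef_fpsD coef_fpsN fps_exp_low // subr0.
Qed.

End FpsInstance.

(** * Balanced two-row arrays *)

Section Master.
Variables (R : comNzRingType) (K : nat).
Implicit Types (m : 'X_{1..K}) (a b : 'I_K) (p : {mpoly R[K]}).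

Definition mnms n : seq 'X_{1..K} :=
  [seq s2m t | t : n.-tuple 'I_K <- enum (basis K n)].

Lemma mem_mnms n m : (m \in mnms n) = (mdeg m == n).
Proof. by rewrite basis_cover. Qed.

Lemma uniq_mnms n : uniq (mnms n). Proof. exact: uniq_basis. Qed.

Lemma mnms0 : mnms 0 = [:: 0%MM].
Proof.
have /perm_small_eq -> // : perm_eq (mnms 0) [:: 0%MM].
apply: uniq_perm => //; first exact: uniq_mnms.
by move=> m; rewrite mem_mnms mdeg_eq0 inE.
Qed.

Lemma big_mnms_shift n b (S : pred 'X_{1..K}) (F : 'X_{1..K} -> R) :
  \sum_(m <- mnms n.+1 | S m && (0 < m b)%N) F m =
  \sum_(m <- mnms n | S (U_(b) + m)%MM) F (U_(b) + m)%MM.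
Proof.
rewrite -big_filter -[RHS]big_filter -(big_map (fun m => U_(b) + m)%MM xpredT F).
apply: perm_big; apply: uniq_perm => [||m].
- by rewrite filter_uniq ?uniq_mnms.
- by rewrite map_inj_uniq ?filter_uniq ?uniq_mnms // => m1 m2 /addmI.
rewrite mem_filter mem_mnms; apply/idP/mapP => [/andP[/andP[Sm m_gt0] deg_m]|].
  have def_m : m = (U_(b) + (m - U_(b)))%MM.
    apply/mnmP => i; rewrite mnmDE mnmBE mnm1E; case: eqP => [<-|_].
      by rewrite subnKC.
    by rewrite subn0.
  exists (m - U_(b))%MM => //; rewrite mem_filter mem_mnms -def_m Sm.
  by move: deg_m; rewrite {1}def_m mdegD mdeg1 eqSS.
case=> m'; rewrite mem_filter mem_mnms => /andP[Sm /eqP deg_m'] ->.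
by rewrite Sm mnmDE mnm1E eqxx mdegD mdeg1 deg_m' eqxx.
Qed.

Lemma mcoeffXM_eq0 a p m : m a = 0%N -> ('X_a * p)@_m = 0.
Proof.
move=> ma0; rewrite mcoeffM big1 // => -[k1 k2] /= /eqP def_m.
rewrite mcoeffX; case: eqP => [def_k1|_]; last by rewrite mul0r.
by have := congr1 (fun m' => m' a) def_m; rewrite -def_k1 mnmDE mnm1E eqxx ma0.
Qed.

Lemma mcoeffXM a p m : ('X_a * p)@_(U_(a) + m) = p@_m.
Proof. by rewrite mulrC mcoeffMX. Qed.

Variable B : 'I_K -> 'I_K -> R.

Definition row_poly a : {mpoly R[K]} := \sum_b B a b *: 'X_b.
(** The coefficient of [m] in [row_mon m] is the one summed in MacMahon's master theorem: it weighs
    the arrays whose second row rearranges the first, a column [(a, b)] having weight [B a b]. *)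
Definition row_mon m : {mpoly R[K]} := \prod_a row_poly a ^+ m a.

Lemma row_mon0 : row_mon 0%MM = 1.
Proof. by rewrite /row_mon big1 // => a _; rewrite mnm0E. Qed.

Lemma row_monS b m : row_mon (U_(b) + m)%MM = row_poly b * row_mon m.
Proof.
rewrite /row_mon (bigD1 b) //= [in RHS](bigD1 b) //= mnmDE mnm1E eqxx exprS mulrA.
by congr (_ * _); apply: eq_bigr => a neq_ab; rewrite mnmDE mnm1E eq_sym (negbTE neq_ab).
Qed.

Definition supp_below k m := [forall b : 'I_K, (k <= b)%N ==> (m b == 0%N)].

Lemma supp_belowP k m :
  reflect (forall b : 'I_K, (k <= b)%N -> m b = 0%N) (supp_below k m).
Proof.
apply: (iffP forallP) => [h b le_kb|h b]; first by have /implyP/(_ le_kb)/eqP := h b.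
by apply/implyP => /h/eqP.
Qed.

(* [balanced k] counts the two-row arrays on the letters below [k]; in
   [open_trail k a] one occurrence of [a] in the second row is traded for one
   of [k], so that reading and deleting the rows letter by letter starting from
   row [a] gives a walk ending at [k]. *)
Definition balanced k : fps R :=
  fun n => \sum_(m <- mnms n | supp_below k m) (row_mon m)@_m.

Definition open_trail (k : 'I_K) a : fps R :=
  fun n => \sum_(m <- mnms n | supp_below k.+1 m) ('X_a * row_mon m)@_(U_(k) + m).

Lemma supp_below0 k : supp_below k 0%MM.
Proof. by apply/supp_belowP => b _; rewrite mnm0E. Qed.

Lemma balanced_at0 k : balanced k 0%N = 1.
Proof.
by rewrite /balanced mnms0 big_mkcond big_seq1 supp_below0 row_mon0 mcoeff1 eqxx.
Qed.

Lemma balanced_init : balanced 0 = 1.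
Proof.
apply/funext => -[|n]; first by rewrite balanced_at0.
rewrite coef_fps1 /balanced big_seq_cond big1 // => m /andP[].
rewrite mem_mnms => /eqP deg_m /supp_belowP m0; move: deg_m.
by rewrite mdegE big1 // => b _; rewrite m0.
Qed.

Lemma open_trail_end (k : 'I_K) : open_trail k k = balanced k.+1.
Proof. by apply/funext => n; apply: eq_bigr => m _; rewrite mcoeffXM. Qed.

(** First-step decomposition. If row [a] is nonempty, its first letter [b] is read with weight
    [B a b], the column is deleted and the walk goes on from row [b]. If it is empty the walk stops,
    which is possible only for [a = k] and leaves an array on the letters below [k]. *)
Lemma open_trail_first (k a : 'I_K) : (a <= k)%N ->
  open_trail k a = \sum_(b : 'I_K | (b <= k)%N) fps_mono (B a b) * open_trail k b
                   + (a == k)%:R * balanced k.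
Proof.
move=> le_ak; apply/funext => -[|n]; rewrite coef_fpsD coef_fps_sum.
  rewrite big1 ?add0r => [|b _]; last exact: coef_mono_mul0.
  rewrite /open_trail mnms0 big_mkcond big_seq1 supp_below0 row_mon0.
  rewrite mulr1 addm0 mcoeffXU.
  by case: eqP => _; rewrite ?mul1r ?balanced_at0 // mul0r coef_fps0.
rewrite {1}/open_trail (bigID (fun m => 0 < m a)%N) /=; congr (_ + _).
  rewrite big_mnms_shift.
  under [RHS]eq_bigr => b _ do rewrite coef_mono_mulS /open_trail mulr_sumr.
  rewrite exchange_big /=; apply: eq_big => [m|m].
    apply/supp_belowP/supp_belowP => h b lt_kb; have := h b lt_kb.
      by rewrite mnmDE => /eqP; rewrite addn_eq0 => /andP[_ /eqP].
    by rewrite mnmDE mnm1E => ->; case: eqP lt_kb => // <-; rewrite ltnNge le_ak.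
  move=> /supp_belowP supp_m; rewrite row_monS addmA [(U_(k) + U_(a))%MM]addmC -addmA.
  rewrite mcoeffXM /row_poly mulr_suml.
  rewrite raddf_sum /= (bigID (fun b : 'I_K => b <= k)%N) /=.
  (* Letters above [k] do not occur in the extracted monomial, so they cannot be read. *)
  rewrite [X in _ + X]big1 ?addr0 => [|b]; last first.
    rewrite -ltnNge => lt_kb; rewrite -scalerAl mcoeffZ mcoeffXM_eq0 ?mulr0 //.
    have := supp_m b lt_kb; rewrite !mnmDE !mnm1E.
    have -> : (k == b) = false by apply/eqP => def_k; rewrite def_k ltnn in lt_kb.
    have -> : (a == b) = false by apply/eqP => def_k; rewrite -def_k ltnNge le_ak in lt_kb.
    by rewrite !add0n.
  by apply: eq_bigr => b _; rewrite -scalerAl mcoeffZ.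
case: eqP => [->|/eqP neq_ak].
  rewrite mul1r /balanced; apply: eq_big => [m|m _]; last by rewrite mcoeffXM.
  apply/andP/supp_belowP => [[/supp_belowP h mk0] b|h].
    rewrite leq_eqVlt => /predU1P[/val_inj <-|/h//].
    by move: mk0; rewrite -leqNgt leqn0 => /eqP.
  by rewrite h // ltnn; split=> //; apply/supp_belowP => b /ltnW/h.
rewrite mul0r coef_fps0 big1 // => m /andP[_]; rewrite -leqNgt leqn0 => /eqP ma0.
by rewrite mcoeffXM_eq0 // mnmDE mnm1E ma0 eq_sym (negbTE neq_ak).
Qed.

End Master.

(** * Elimination *)

Section Elimination.
Variables (A : comNzRingType) (p q r : nat -> A).

Definition diag_prod k : A := \prod_(0 <= i < k) (1 - q i + p i).
(** [diag_prod k - offdiag_sum k] is the determinant of the leading [k] by [k] block of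
    [1 - split_entry]. *)
Fixpoint offdiag_sum k : A :=
  if k is k'.+1 then (1 - q k' + r k') * offdiag_sum k' + p k' * diag_prod k'
  else 0.

Definition split_entry a b : A :=
  if (b < a)%N then p b else if b == a then q b else r b.

(* The row vector [lam] below, whose partial sums are [Lam], is proportional to
   the last row of the adjugate of [1 - split_entry]. *)
Lemma split_system_solve (t : nat -> A) k G :
    (forall a, (a <= k)%N ->
       t a = \sum_(0 <= b < k.+1) split_entry a b * t b + (a == k)%:R * G) ->
  (diag_prod k.+1 - offdiag_sum k.+1) * t k = (diag_prod k - offdiag_sum k) * G.
Proof.
move=> eq_t.
(* The separate value [diag_prod k] at [k.+1] is the total sum of [lam]; hence the tail sums
   [diag_prod k - Lam b.+1]. *)
pose Lam b := if (b <= k)%N then offdiag_sum b * \prod_(b <= i < k) (1 - q i + p i)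
              else diag_prod k.
have LamE b : (b <= k)%N -> Lam b = offdiag_sum b * \prod_(b <= i < k) (1 - q i + p i).
  by rewrite /Lam => ->.
have LamS : Lam k.+1 = diag_prod k by rewrite /Lam ltnn.
have Lam0 : Lam 0%N = 0 by rewrite LamE //= mul0r.
clearbody Lam; pose lam a := Lam a.+1 - Lam a.
have lamE a : lam a = Lam a.+1 - Lam a by [].
have sum_lam b : \sum_(0 <= a < b) lam a = Lam b.
  by rewrite telescope_sumr // Lam0 subr0.
have sum_lamr b : (b <= k)%N -> \sum_(b.+1 <= a < k.+1) lam a = diag_prod k - Lam b.+1.
  by move=> le_bk; rewrite telescope_sumr // LamS.
clearbody lam.
have lam_k : lam k = diag_prod k - offdiag_sum k.
  by rewrite lamE LamS LamE // big_geq // mulr1.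
(* In column [b] the rows above the diagonal carry [r b] and those below carry [p b], so only
   partial sums of [lam] enter. *)
have col b : (b <= k)%N -> \sum_(0 <= a < k.+1) lam a * split_entry a b =
    r b * Lam b + q b * lam b + p b * (diag_prod k - Lam b.+1).
  move=> le_bk; rewrite (big_cat_nat (n := b)) //=; last exact: leqW.
  rewrite [X in _ + X]big_ltn // addrA -sum_lam -sum_lamr // !mulr_sumr.
  congr (_ + _ + _); last 1 first.
  - by apply: eq_big_nat => a /andP[lt_ba _]; rewrite /split_entry lt_ba mulrC.
  - apply: eq_big_nat => a /= lt_ab; rewrite /split_entry ltnNge ltnW //=.
    by rewrite gtn_eqF // mulrC.
  - by rewrite /split_entry ltnn eqxx mulrC.
have : \sum_(0 <= a < k.+1) lam a * t a =
    \sum_(0 <= b < k.+1) (\sum_(0 <= a < k.+1) lam a * split_entry a b) * t b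
    + lam k * G.
  under eq_big_nat => a lt_a do rewrite (eq_t a lt_a) mulrDr mulr_sumr.
  rewrite big_split /=; congr (_ + _).
    rewrite exchange_big /=; apply: eq_bigr => b _; rewrite mulr_suml.
    by apply: eq_bigr => a _; rewrite mulrA.
  rewrite big_nat_recr //= eqxx mul1r big_nat_cond big1 ?add0r // => a.
  by rewrite andbT => /andP[_ lt_ak]; rewrite ltn_eqF // mul0r mulr0.
rewrite [LHS]big_nat_recr // [X in _ = X + _]big_nat_recr //= -lam_k.
move=> /eqP; rewrite -subr_eq0 => /eqP eq0.
apply/eqP; rewrite -subr_eq0; apply/eqP; rewrite -[RHS]eq0.
(* For [b < k] the matrix reproduces [lam] in column [b], so these terms cancel and only the unknown
   [t k] remains. *)
have -> : \sum_(0 <= b < k) (\sum_(0 <= a < k.+1) lam a * split_entry a b) * t b =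
          \sum_(0 <= b < k) lam b * t b.
  apply: eq_big_nat => b /= lt_bk; have le_bk := ltnW lt_bk.
  congr (_ * _); rewrite col //.
  rewrite lamE !LamE //=.
  have -> : diag_prod k = diag_prod b * \prod_(b <= i < k) (1 - q i + p i).
    by rewrite -big_cat_nat // ltnW.
  rewrite ![\prod_(b <= i < k) _]big_ltn //.
  by ring.
rewrite col // lam_k LamS LamE //  [\prod_(k <= i < k) _]big_geq // mulr1.
by rewrite /diag_prod big_nat_recr //= -/(diag_prod k); ring.
Qed.

End Elimination.

Section MasterSplit.
Variables (R : comNzRingType) (K : nat) (p q r : nat -> R).
Let B (a b : 'I_K) := split_entry p q r a b.
Let pu i := fps_mono (p i).
Let qu i := fps_mono (q i).
Let ru i := fps_mono (r i).

(** The trails ending at [k] solve the system with [G = balanced k], and the trail starting at [k]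
    is [balanced k.+1]. Elimination then shows that the determinant times [balanced] takes the same
    value at [k] and [k.+1]. *)
Lemma balanced_split k : (k <= K)%N ->
  (diag_prod pu qu k - offdiag_sum pu qu ru k) * balanced B k = 1.
Proof.
elim: k => [|k IHk] lt_kK.
  by rewrite balanced_init /diag_prod big_geq //= subr0 mulr1.
rewrite -(IHk (ltnW lt_kK)) -(open_trail_end B (Ordinal lt_kK)).
pose t a := if insub a is Some a' then open_trail B (Ordinal lt_kK) a' else 0.
have tE (a : 'I_K) : t a = open_trail B (Ordinal lt_kK) a.
  by rewrite /t; case: insubP => [a' _ /val_inj-> //|]; rewrite ltn_ord.
rewrite -tE /=; apply: split_system_solve => a le_ak.
have lt_aK := leq_ltn_trans le_ak lt_kK.
rewrite -[a]/(val (Ordinal lt_aK)) tE open_trail_first //; congr (_ + _).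
rewrite (big_nat_widen _ _ K) // big_mkord; apply: eq_big => // b _.
rewrite tE; congr (_ * _); rewrite /B /split_entry /=.
by case: ltnP => // _; case: eqP.
Qed.

End MasterSplit.

(** * Rows with a forbidden loop *)

Section Edges.
Variables (R : comNzRingType) (K : nat) (B : 'I_K -> 'I_K -> R).
Implicit Types (E : seq 'I_K) (m : 'X_{1..K}).

Definition edge_factor E m b : {mpoly R[K]} :=
  if (b \in E) && (0 < m b)%N then
    (row_poly B b - B b b *: 'X_b) * row_poly B b ^+ (m b).-1
  else row_poly B b ^+ m b.

(* Rows in [E] may not have the loop letter in one distinguished column. *)
Definition edge_series E : fps R :=
  fun n => \sum_(m <- mnms K n) (\prod_b edge_factor E m b)@_m.

Lemma edge_series_nil : edge_series [::] = balanced B K.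
Proof.
apply/funext => n; apply: eq_bigl => m; apply/esym/supp_belowP => b.
by rewrite leqNgt ltn_ord.
Qed.

(** The terms lost in row [b] have the loop [(b, b)] in the distinguished column. Deleting that
    column leaves an array with one column less and row [b] unrestricted, hence the subtracted
    [fps_mono (B b b)]. *)
Lemma edge_series_cons b E : b \notin E ->
  edge_series (b :: E) = (1 - fps_mono (B b b)) * edge_series E.
Proof.
move=> bE; apply/funext => n; rewrite mulrBl mul1r coef_fpsD coef_fpsN.
pose rest m := \prod_(c | c != b) edge_factor E m c.
have step m : (\prod_c edge_factor (b :: E) m c)@_m = (\prod_c edge_factor E m c)@_m
    - (if (0 < m b)%N then B b b * ('X_b * (row_poly B b ^+ (m b).-1 * rest m))@_m else 0).
  rewrite (bigD1 b) //= [\prod_c edge_factor E m c](bigD1 b) //= -/(rest m).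
  have -> : \prod_(c | c != b) edge_factor (b :: E) m c = rest m.
    by apply: eq_bigr => c neq_cb; rewrite /edge_factor inE (negbTE neq_cb).
  rewrite /edge_factor inE eqxx (negbTE bE) /=.
  case: posnP => [->|mb_gt0] /=; first by rewrite subr0.
  rewrite -mulrA mulrBl mcoeffB -scalerAl mcoeffZ; congr (_ - _).
  by rewrite mulrA -exprS prednK.
rewrite /edge_series; under eq_bigr => m _ do rewrite step.
rewrite big_split /= sumrN; congr (_ - _); rewrite -big_mkcond /=.
case: n => [|n].
  rewrite coef_mono_mul0 big_seq_cond big1 // => m; rewrite mem_mnms mdeg_eq0.
  by case/andP => /eqP->; rewrite mnm0E.
rewrite coef_mono_mulS mulr_sumr (big_mnms_shift n b xpredT) /=.
apply: eq_bigr => m _; rewrite mcoeffXM; congr (_ * _@_ _).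
rewrite [RHS](bigD1 b) //=; congr (_ * _).
  by rewrite /edge_factor (negbTE bE) /= mnmDE mnm1E eqxx.
by apply: eq_bigr => c neq_cb; rewrite /edge_factor mnmDE mnm1E eq_sym (negbTE neq_cb).
Qed.

Lemma edge_seriesE E : uniq E ->
  edge_series E = \prod_(b <- E) (1 - fps_mono (B b b)) * balanced B K.
Proof.
elim: E => [|b E IHE] => [_|/= /andP[bE /IHE defE]].
  by rewrite big_nil mul1r edge_series_nil.
by rewrite edge_series_cons // defE big_cons mulrA.
Qed.

End Edges.

(** * Permutations increasing on blocks *)

Section BlockPermutations.
Variables (n K : nat).
Implicit Types (c : 'I_n -> 'I_K) (s : 'S_n).

Definition nondecreasing c := forall i j : 'I_n, (i <= j)%N -> (c i <= c j)%N.

Definition block_increasing c s :=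
  [forall i : 'I_n, forall j : 'I_n, (i < j)%N && (c i == c j) ==> (s i < s j)%N].

Lemma block_increasingP c s :
  reflect (forall i j : 'I_n, (i < j)%N -> c i = c j -> (s i < s j)%N)
          (block_increasing c s).
Proof.
apply: (iffP 'forall_forallP) => [h i j lt_ij eq_c|h i j].
  by have /implyP := h i j; apply; rewrite lt_ij eq_c eqxx.
by apply/implyP => /andP[lt_ij /eqP]; apply: h.
Qed.

(** The positions of a block are consecutive and [s] increases there, so stepping back from [M]
    lowers [s] at least as much as the position. The offset [d] is 1 for strict kinds and 0 for
    fixed points. *)
Lemma block_bounded_above c s d (M i : 'I_n) :
    nondecreasing c -> block_increasing c s -> c i = c M -> (i <= M)%N ->
    (forall j, c j = c M -> (s j + d <= M)%N) ->
  (s i + d <= i)%N.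
Proof.
move=> mono_c /block_increasingP incr_s eq_c le_iM bound.
have [k] := ubnP (M - i); elim: k => // k IHk in i eq_c le_iM *.
case: (ltngtP i M) le_iM => // [lt_iM _|/val_inj -> _ _]; last exact: bound.
move=> lt_k; pose j := Ordinal (leq_ltn_trans lt_iM (ltn_ord M)).
have eq_cj : c j = c M.
  apply/val_inj/eqP; rewrite eqn_leq mono_c //= -eq_c mono_c //=.
have := IHk j eq_cj lt_iM; have := incr_s i j (ltnSn i); rewrite eq_c eq_cj.
by move=> /(_ erefl) lt_s /= le_s; have := le_s; lia.
Qed.

Lemma block_bounded_below c s d (M i : 'I_n) :
    nondecreasing c -> block_increasing c s -> c i = c M -> (M <= i)%N ->
    (forall j, c j = c M -> (M + d <= s j)%N) ->
  (i + d <= s i)%N.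
Proof.
move=> mono_c /block_increasingP incr_s eq_c le_Mi bound.
have [k] := ubnP (i - M); elim: k => // k IHk in i eq_c le_Mi *.
case: (ltngtP M i) le_Mi => // [lt_Mi _|/val_inj <- _ _]; last exact: bound.
move=> lt_k; have lt_jn : (i.-1 < n)%N by rewrite (leq_ltn_trans (leq_pred _)).
pose j := Ordinal lt_jn; have ltji : (j < i)%N by rewrite /=; lia.
have le_Mj : (M <= j)%N by rewrite /=; lia.
have eq_cj : c j = c M.
  by apply/val_inj/eqP; rewrite eqn_leq -{1}eq_c !mono_c //= ltnW.
have := IHk j eq_cj le_Mj; have := incr_s j i ltji; rewrite eq_c eq_cj.
by move=> /(_ erefl) lt_s /= le_s; have := le_s; lia.
Qed.

(* The kind of a letter is 0, 1 or 2 according as it stands for an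
   anti-excedance, a fixed point or an excedance of the permutation. *)
Variable kind : 'I_K -> nat.

Definition kind_rel (k x y : nat) : bool :=
  if k == 0%N then (x < y)%N else if k == 1%N then x == y else (y < x)%N.

Definition kind_match c s := [forall i, kind_rel (kind (c i)) (s i) i].

(** The coarse form of [kind_rel] in the column [p = s i], with [b = c i] and [a = c p]: comparing
    [p] with [i] becomes comparing their blocks. *)
Definition row_allows (a b : 'I_K) : bool :=
  if kind b == 0%N then (a <= b)%N else if kind b == 1%N then a == b else (b <= a)%N.

(** A block of anti-excedances takes no value at its own last position, a block of excedances none
    at its own first position. *)
Definition block_edge c (p : 'I_n) (b : 'I_K) : bool :=
  if kind b == 0%N then [forall q, (c q == b) ==> (q <= p)%N]
  else if kind b == 1%N then false else [forall q, (c q == b) ==> (p <= q)%N].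

Definition column_allows c (p : 'I_n) (b : 'I_K) : bool :=
  row_allows (c p) b && ~~ ((c p == b) && block_edge c p b).

(** For the converse, the values of a block of anti-excedances lie in earlier blocks or in the block
    itself, but not at its last position [M]; so they are below [M], and stepping back from [M]
    gives [s i < i]. Excedances are symmetric, with the first position [L]. A block of fixed points
    maps into itself, so both bounds apply with [d = 0]. *)
Lemma kind_matchE c s : nondecreasing c -> block_increasing c s ->
  kind_match c s = [forall i, column_allows c (s i) (c i)].
Proof.
move=> mono_c incr_s; apply/forallP/forallP => h i; have := h i.
  rewrite /kind_rel /column_allows /row_allows /block_edge.
  case: eqP => _; last case: eqP => _.
  - move=> lt_si; rewrite mono_c 1?ltnW //=; apply/nandP; right.
    by apply/forallPn; exists i; rewrite eqxx /= -ltnNge.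
  - by move=> /eqP/val_inj->; rewrite eqxx.
  - move=> lt_si; rewrite mono_c 1?ltnW //=; apply/nandP; right.
    by apply/forallPn; exists i; rewrite eqxx /= -ltnNge.
have [M /eqP cM maxM] := @arg_maxnP _ i (fun j => c j == c i) val (eqxx _).
have [L /eqP cL minL] := @arg_minnP _ i (fun j => c j == c i) val (eqxx _).
move: maxM minL => /= maxM minL.
have le_iM := maxM i (eqxx _); have le_Li := minL i (eqxx _).
rewrite /kind_rel /column_allows /row_allows /block_edge.
case k0 : (kind (c i) == 0%N); last case k1 : (kind (c i) == 1%N).
- move=> _; rewrite -addn1; apply: (block_bounded_above (c := c) (M := M)) => // j cj.
  have := h j; rewrite /column_allows /row_allows /block_edge cj cM k0.
  case/andP => le_c; rewrite addn1 ltnNge; apply: contra => le_M.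
  have eq_c : c (s j) = c i.
    by apply/val_inj/eqP; rewrite eqn_leq le_c -cM mono_c.
  rewrite eq_c eqxx /=; apply/forallP => q; apply/implyP => /maxM le_qM.
  exact: leq_trans le_M.
- move=> _; rewrite eqn_leq -[X in (X <= i)%N]addn0 -[X in (_ && (X <= _))%N]addn0.
  rewrite (block_bounded_above (c := c) (M := M))
    ?(block_bounded_below (c := c) (M := L)) // => j cj;
    have := h j; rewrite /column_allows /row_allows /block_edge cj ?cM ?cL k0 k1;
    case/andP => eq_c _; rewrite addn0.
  + exact: minL.
  + exact: maxM.
- move=> _; rewrite -addn1; apply: (block_bounded_below (c := c) (M := L)) => // j cj.
  have := h j; rewrite /column_allows /row_allows /block_edge cj cL k0 k1.
  case/andP => le_c; rewrite addn1 ltnNge; apply: contra => le_M.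
  have eq_c : c (s j) = c i.
    by apply/val_inj/eqP; rewrite eqn_leq le_c -cL mono_c.
  rewrite eq_c eqxx /=; apply/forallP => q; apply/implyP => /minL le_qM.
  exact: leq_trans le_M _.
Qed.

(* Strong induction: the preimage under [t] of [s i] lies in the block of [i],
   and not before [i]. *)
Lemma block_increasing_inj c s t :
    block_increasing c s -> block_increasing c t ->
    (forall p, c ((s^-1)%g p) = c ((t^-1)%g p)) -> s = t.
Proof.
have le_half (s1 s2 : 'S_n) (i : 'I_n) : block_increasing c s2 ->
    (forall p, c ((s1^-1)%g p) = c ((s2^-1)%g p)) ->
    (forall j : 'I_n, (j < i)%N -> s1 j = s2 j) -> (s2 i <= s1 i)%N.
  move=> /block_increasingP incr eqc IH; pose a := (s2^-1)%g (s1 i).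
  have s2a : s2 a = s1 i by rewrite permKV.
  have ca : c i = c a by rewrite -eqc permK.
  case: (ltngtP a i) => [lt_ai|lt_ia|/val_inj eq_ai].
  - have := IH a lt_ai; rewrite s2a => /perm_inj eq_ai.
    by rewrite eq_ai ltnn in lt_ai.
  - by rewrite -s2a ltnW // incr.
  - by rewrite -s2a eq_ai.
move=> incr_s incr_t eqc; apply/permP => i.
have [k] := ubnP (i : nat); elim: k => // k IHk in i * => lt_ik.
have IH (j : 'I_n) : (j < i)%N -> s j = t j.
  by move=> lt_ji; apply: IHk; exact: leq_trans lt_ji lt_ik.
apply/val_inj/eqP; rewrite eqn_leq; apply/andP; split; apply: le_half => // j ltj.
by rewrite IH.
Qed.

(* Among the permutations carrying [c] to [v], one maximising [\sum_i i * s i]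
   has no inversion inside a block. *)
Lemma block_increasing_exists c (v : 'I_n -> 'I_K) s0 :
  (forall i, v (s0 i) = c i) ->
  exists2 s, block_increasing c s & forall i, v (s i) = c i.
Proof.
move=> v0; pose P (s : 'S_n) := [forall i, v (s i) == c i].
have P0 : P s0 by apply/forallP => i; rewrite v0.
have [s Ps maxs] := @arg_maxnP _ s0 P (fun s : 'S_n => \sum_(i < n) i * s i)%N P0.
exists s => [|i]; last by have /forallP/(_ i)/eqP := Ps.
apply/block_increasingP => i j lt_ij eq_c; rewrite ltnNge; apply/negP => le_s.
have neq_ij : i != j by rewrite neq_ltn lt_ij.
have neq_ji : j != i by rewrite eq_sym.
have lt_s : (s j < s i)%N.
  rewrite ltn_neqAle le_s andbT; apply: contra neq_ij => /eqP/val_inj/perm_inj->.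
  exact: eqxx.
have /maxs : P (tperm i j * s)%g.
  apply/forallP => k; rewrite permM; have /forallP/(_ (tperm i j k))/eqP-> := Ps.
  by case: tpermP => [->|->|//]; rewrite eq_c.
rewrite /= leqNgt => /negP; apply.
rewrite (bigD1 i) //= (bigD1 j) //= [in X in (_ < X)%N](bigD1 i) //=.
rewrite [in X in (_ < X)%N](bigD1 j) //= !permM tpermL tpermR !addnA.
rewrite (eq_bigr (fun k : 'I_n => k * (tperm i j * s)%g k)%N) => [|k]; last first.
  by case/andP => neq_ki neq_kj; rewrite permM tpermD // eq_sym.
by rewrite ltn_add2r; nia.
Qed.

End BlockPermutations.

(** * Block-increasing permutations as rearranged words *)

Section WordContent.
Variables (n K : nat).

Lemma s2m_tnthE (t : n.-tuple 'I_K) : s2m t = (\sum_(p < n) U_(tnth t p))%MM.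
Proof.
apply/mnmP => b; rewrite mnmE mnm_sumE -sum1_count big_tuple big_mkcond /=.
by apply: eq_bigr => p _; rewrite mnm1E; case: eqP.
Qed.

Lemma basis_nondecreasing (t : n.-tuple 'I_K) :
  t \in basis K n -> nondecreasing (tnth t).
Proof.
rewrite inE => sorted_t i j le_ij; pose x0 := tnth t i.
rewrite !(tnth_nth x0) -!(nth_map x0 0%N val) ?size_tuple //.
by apply: sorted_leq_nth => //; rewrite ?inE ?size_map ?size_tuple //; exact: leq_trans.
Qed.

Lemma content_perm (c v : 'I_n -> 'I_K) :
    (\sum_(p < n) U_(v p) = \sum_(p < n) U_(c p))%MM ->
  exists s : 'S_n, forall i, v (s i) = c i.
Proof.
move=> eq_vc; pose tc := [tuple c i | i < n]; pose tv := [tuple v i | i < n].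
have /tuple_permP[s def_c] : perm_eq tc tv.
  have countE (u : 'I_n -> 'I_K) b :
      count_mem b [tuple u i | i < n] = (\sum_(p < n) U_(u p)%MM b)%N.
    rewrite -sum1_count big_map big_enum_cond big_mkcond.
    by apply: eq_bigr => p _; rewrite mnm1E /=; case: eqP.
  apply/allP => b _; apply/eqP; rewrite /= !countE -!mnm_sumE.
  exact/esym/(congr1 (fun m : 'X_{1..K} => m b)).
exists s => i; have /(congr1 (fun s => nth (c i) s i)) := def_c.
have nthE (u : n.-tuple 'I_K) : nth (c i) u i = tnth u i by rewrite -tnth_nth.
by rewrite !nthE !tnth_mktuple.
Qed.

End WordContent.

Section BlockSums.
Variables (R : comNzRingType) (n K : nat) (kind : 'I_K -> nat) (w : 'I_K -> R).

(* A block-increasing [s] corresponds to the word [v p = c (s^-1 p)], an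
   arbitrary rearrangement of [c]. *)
Lemma sum_block_increasing (c : 'I_n -> 'I_K) : nondecreasing c ->
  \sum_(s : 'S_n | block_increasing c s && kind_match kind c s) \prod_i w (c i) =
  (\prod_p \sum_b ((column_allows kind c p b)%:R * w b) *: 'X_b)@_(\sum_p U_(c p)).
Proof.
move=> mono_c; rewrite bigA_distr_bigA raddf_sum /=.
pose h (s : 'S_n) : {ffun 'I_n -> 'I_K} := [ffun p => c ((s^-1)%g p)].
pose A := [set s : 'S_n | block_increasing c s].
pose W := [set v : {ffun 'I_n -> 'I_K} | (\sum_p U_(v p) == \sum_p U_(c p))%MM].
pose F (v : {ffun 'I_n -> 'I_K}) :=
  if [forall p, column_allows kind c p (v p)] then \prod_p w (v p) else 0.
have sum_h (s : 'S_n) : (\sum_p U_(h s p) = \sum_p U_(c p))%MM.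
  rewrite (reindex_inj (@perm_inj _ s)) /=.
  by apply: eq_bigr => p _; rewrite ffunE permK.
have def_W : W = h @: A.
  apply/setP => v; rewrite inE; apply/eqP/imsetP => [|[s _ ->]]; last exact: sum_h.
  case/content_perm => s0 /block_increasing_exists[s incr_s def_v].
  exists s; first by rewrite inE.
  by apply/ffunP => p; rewrite ffunE -def_v permKV.
transitivity (\sum_(v in W) F v); last first.
  rewrite big_mkcond; apply: eq_bigr => v _.
  have prodX : \prod_p 'X_(v p) = 'X_[\sum_p U_(v p)] :> {mpoly R[K]}.
    by rewrite (big_morph _ (@mpolyXD K R) (@mpolyX0 K R)).
  rewrite scaler_prod prodX mcoeffZ mcoeffX inE /F.
  case: eqP => _; rewrite ?mulr0 // mulr1.
  case: forallP => [allow_v|/forallP/forallPn[p nallow]].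
    by apply: eq_bigr => p _; rewrite allow_v mul1r.
  by rewrite (bigD1 p) //= (negbTE nallow) mul0r mul0r.
rewrite def_W big_imset /=; last first.
  move=> s1 s2; rewrite !inE => incr1 incr2 eq_h; apply: block_increasing_inj incr1 incr2 _.
  by move=> p; have /ffunP/(_ p) := eq_h; rewrite !ffunE.
rewrite big_mkcondr; apply: eq_big => [s|s incr_s]; first by rewrite inE.
rewrite kind_matchE // /F.
have -> : [forall p, column_allows kind c p (h s p)] =
          [forall i, column_allows kind c (s i) (c i)].
  apply/forallP/forallP => allow p; last by rewrite ffunE -{1}(permKV s p).
  by have := allow (s p); rewrite ffunE permK.
case: ifP => // _; rewrite [RHS](reindex_inj (@perm_inj _ s)) /=.
by apply: eq_bigr => i _; rewrite ffunE permK.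
Qed.

Definition kind_entry (a b : 'I_K) : R := (row_allows kind a b)%:R * w b.

Definition moving_letters : seq 'I_K := [seq b <- enum 'I_K | kind b != 1%N].

(** The edge is the last position of the block for anti-excedances and the first one for
    excedances. *)
Lemma block_edge_unique (c : 'I_n -> 'I_K) b (i : 'I_n) : kind b != 1%N -> c i = b ->
  exists p0, forall p, (c p == b) && block_edge kind c p b = (p == p0).
Proof.
move=> /negbTE k1 /eqP ci; rewrite /block_edge k1; case: (kind b == 0%N).
  have [M cM maxM] := @arg_maxnP _ i (fun j => c j == b) val ci.
  exists M => p; apply/andP/eqP => [[cp edge_p]|->].
    have /implyP/(_ cM) := forallP edge_p M => le_Mp.
    apply/val_inj/eqP; rewrite eqn_leq le_Mp andbT.
    exact: maxM.
  by split=> //; apply/forallP => q; apply/implyP; exact: maxM.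
have [M cM minM] := @arg_minnP _ i (fun j => c j == b) val ci.
exists M => p; apply/andP/eqP => [[cp edge_p]|->].
  have /implyP/(_ cM) := forallP edge_p M => le_pM; apply/val_inj/eqP; rewrite eqn_leq le_pM /=.
  exact: minM.
by split=> //; apply/forallP => q; apply/implyP; exact: minM.
Qed.

(** Columns are grouped by the block of their position: each contributes the row polynomial of that
    block, with the loop removed at the edge. *)
Lemma column_prodE (c : 'I_n -> 'I_K) :
  \prod_p \sum_b ((column_allows kind c p b)%:R * w b) *: 'X_b =
  \prod_b edge_factor kind_entry moving_letters (\sum_p U_(c p))%MM b.
Proof.
rewrite (partition_big c xpredT) //=; apply: eq_bigr => b _.
set P := row_poly kind_entry b.
have colE p : c p = b -> \sum_b0 ((column_allows kind c p b0)%:R * w b0) *: 'X_b0 =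
    if block_edge kind c p b then P - kind_entry b b *: 'X_b else P.
  move=> cp; rewrite /P /row_poly; case: ifP => edge_p.
    rewrite [X in X - _](bigD1 b) //= addrAC subrr add0r (bigD1 b) //=.
    rewrite /column_allows cp eqxx edge_p andbF mul0r scale0r add0r.
    apply: eq_bigr => b0 neq_b0; rewrite /kind_entry [_ == b0]eq_sym.
    by rewrite (negbTE neq_b0) andbT.
  apply: eq_bigr => b0 _; rewrite /column_allows cp /kind_entry.
  by case: eqP => [<-|_]; rewrite ?edge_p andbT.
have contE : (\sum_p U_(c p))%MM b = #|[pred p | c p == b]|.
  rewrite mnm_sumE -sum1_card [RHS]big_mkcond /=.
  by apply: eq_bigr => p _; rewrite mnm1E inE; case: eqP.
under eq_bigr => p /eqP cp do rewrite (colE p cp).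
rewrite /edge_factor contE mem_filter mem_enum andbT -/P.
case: (pickP [pred p | c p == b]) => [i /= /eqP ci|none]; last first.
  rewrite big_pred0 // (eq_card0 none) andbF expr0 //.
have card_gt0 : (0 < #|[pred p | c p == b]|)%N by apply/card_gt0P; exists i; rewrite inE ci.
rewrite card_gt0 andbT; case: ifP => [k1|/negbFE k1]; last first.
  under eq_bigr => p _ do rewrite /block_edge (eqP k1) /=.
  by rewrite prodr_const.
have [p0 edgeE] := block_edge_unique k1 ci.
have /andP[cp0 edge_p0] : (c p0 == b) && block_edge kind c p0 b by rewrite edgeE.
rewrite (bigD1 p0) //= edge_p0; congr (_ * _).
rewrite (eq_bigr (fun=> P)) => [|p /andP[cp neq_p]]; last first.
  by have := edgeE p; rewrite cp /= (negbTE neq_p) => ->.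
rewrite prodr_const; congr (_ ^+ _).
rewrite (cardD1 p0 [pred p | c p == b]) inE cp0 /=.
by apply: eq_card => p; rewrite !inE andbC.
Qed.

Lemma sum_compatible_pairs :
  \sum_(t in basis K n) \sum_(s : 'S_n | block_increasing (tnth t) s &&
      kind_match kind (tnth t) s) \prod_i w (tnth t i) =
  edge_series kind_entry moving_letters n.
Proof.
rewrite /edge_series /mnms big_map big_enum; apply: eq_bigr => t t_basis.
rewrite s2m_tnthE -column_prodE; apply: sum_block_increasing.
exact: basis_nondecreasing.
Qed.

End BlockSums.

(** * The series [Sm] *)

(* A letter [l < 3 (m + 1)] stands for the colour [m - l / 3] together with the
   kind [l mod 3]; the letters are numbered in the order in which their blocks
   appear when the colours weakly decrease. *)
Definition letter_color m (l : nat) : nat := m - l %/ 3.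
Definition letter_kind (l : nat) : nat := l %% 3.

Section LetterSystem.
Variables (A : comNzRingType) (m : nat) (x y z : nat -> A).

Definition letter_val l : A :=
  if letter_kind l == 0%N then y (letter_color m l)
  else if letter_kind l == 1%N then z (letter_color m l) else x (letter_color m l).

(** An excedance letter may also stand in later rows and an anti-excedance letter in earlier ones;
    these are the entries below and above the diagonal. *)
Definition letter_before l := if letter_kind l == 2 then letter_val l else 0.
Definition letter_after l := if letter_kind l == 0%N then letter_val l else 0.

Let diag := diag_prod letter_before letter_val.
Let offdiag := offdiag_sum letter_before letter_val letter_after.

Lemma letter_kindE t i : (i < 3)%N -> letter_kind (3 * t + i) = i.
Proof. by rewrite /letter_kind; lia. Qed.
Lemma letter_colorE t i : (i < 3)%N -> letter_color m (3 * t + i) = (m - t)%N.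
Proof. by rewrite /letter_color; lia. Qed.

(** The letters of one colour come in the order [y], [z], [x]. They multiply [diag] by [1 - y],
    [1 - z], [1] and [offdiag] by [1], [1 - z], [1 - x]; the letter [x] also adds [x] times the
    current [diag]. *)
Lemma letter_step t : let i := (m - t)%N in
  diag (3 * t.+1) = diag (3 * t) * (1 - y i) * (1 - z i) /\
  offdiag (3 * t.+1) = (1 - x i) * (1 - z i) * offdiag (3 * t)
                       + x i * (1 - y i) * (1 - z i) * diag (3 * t).
Proof.
move=> i; have -> : (3 * t.+1 = (3 * t).+3)%N by lia.
have valE j : (j < 3)%N -> letter_val (3 * t + j) =
    if j == 0%N then y i else if j == 1%N then z i else x i.
  by move=> ltj; rewrite /letter_val letter_kindE // letter_colorE.
have diagE k : diag k.+1 = diag k * (1 - letter_val k + letter_before k).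
  by rewrite /diag /diag_prod big_nat_recr.
have offE k : offdiag k.+1 = (1 - letter_val k + letter_after k) * offdiag k
                             + letter_before k * diag k by [].
rewrite !diagE !offE !diagE /letter_before /letter_after.
have -> : letter_kind (3 * t) = 0%N by rewrite /letter_kind; lia.
have -> : letter_kind (3 * t).+1 = 1%N by rewrite /letter_kind; lia.
have -> : letter_kind (3 * t).+2 = 2%N by rewrite /letter_kind; lia.
have -> : letter_val (3 * t) = y i by rewrite -[(3 * t)%N]addn0 valE.
have -> : letter_val (3 * t).+1 = z i by rewrite -addn1 valE.
have -> : letter_val (3 * t).+2 = x i by rewrite -addn2 valE.
by rewrite /=; split; ring.
Qed.

Lemma letter_diag t : (t <= m.+1)%N ->
  diag (3 * t) = \prod_(m.+1 - t <= a < m.+1) ((1 - y a) * (1 - z a)).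
Proof.
elim: t => [|t IHt] le_t; first by rewrite /diag /diag_prod !big_geq // subn0.
have [-> _] := letter_step t; rewrite IHt ?(ltnW le_t) // subSS.
by rewrite [in RHS]big_ltn ?ltnS ?leq_subr // subSn // -mulrA mulrC.
Qed.

Lemma letter_offdiag t : (t <= m.+1)%N ->
  offdiag (3 * t) = \prod_(m.+1 - t <= a < m.+1) (1 - z a) *
    \sum_(m.+1 - t <= l < m.+1) x l * \prod_(l <= a < m.+1) (1 - y a)
                             * \prod_(m.+1 - t <= b < l) (1 - x b).
Proof.
elim: t => [|t IHt] le_t; first by rewrite [X in _ * X]big_geq ?subn0 // mulr0.
have [_ ->] := letter_step t; rewrite IHt ?(ltnW le_t) // letter_diag ?(ltnW le_t) //.
rewrite subSS subSn //; set i := (m - t)%N.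
have lt_i : (i < m.+1)%N by rewrite ltnS leq_subr.
rewrite big_split /= [\prod_(i <= a < _) _]big_ltn // [\sum_(i <= l < _) _]big_ltn //.
rewrite [\prod_(i <= a < _) _]big_ltn // [\prod_(i <= b < i) _]big_geq // mulr1.
have -> : \sum_(i.+1 <= l < m.+1) x l * \prod_(l <= a < m.+1) (1 - y a)
                                      * \prod_(i <= b < l) (1 - x b)
  = (1 - x i) * \sum_(i.+1 <= l < m.+1) x l * \prod_(l <= a < m.+1) (1 - y a)
                                      * \prod_(i.+1 <= b < l) (1 - x b).
  rewrite mulr_sumr; apply: eq_big_nat => l /andP[lt_il _].
  by rewrite [in LHS](big_ltn lt_il); ring.
by ring.
Qed.

Lemma letter_moving t : (t <= m.+1)%N ->
  \prod_(0 <= l < 3 * t | letter_kind l != 1%N) (1 - letter_val l)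
  = \prod_(m.+1 - t <= a < m.+1) (1 - y a) * \prod_(m.+1 - t <= a < m.+1) (1 - x a).
Proof.
elim: t => [|t IHt] le_t; first by rewrite !big_geq ?subn0 // mulr1.
have -> : (3 * t.+1 = (3 * t).+3)%N by lia.
rewrite big_mkcond 3?[\prod_(0 <= l < _.+1) _]big_nat_recr //= -big_mkcond IHt ?(ltnW le_t) //.
have [k0 k1 k2] : [/\ letter_kind (3 * t) = 0, letter_kind (3 * t).+1 = 1 &
    letter_kind (3 * t).+2 = 2]%N by rewrite /letter_kind; split; lia.
have [c0 c2] : letter_color m (3 * t) = (m - t)%N /\ letter_color m (3 * t).+2 = (m - t)%N.
  by rewrite /letter_color; split; lia.
rewrite /letter_val k0 k1 k2 c0 c2 /= subSS subSn //.
have lt_i : (m - t < m.+1)%N by rewrite ltnS leq_subr.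
by rewrite ![\prod_(m - t <= a < _) _]big_ltn //; ring.
Qed.

(** The summand [l = 0] of [offdiag] merges with [diag] into the factor [1 - x 0], which all other
    summands contain too. Here [v l] is the inverse of the first [l] factors [1 - y a], turning a
    tail product into the full one. *)
Lemma letter_systemE (v : nat -> A) :
    (forall l, \prod_(0 <= a < l) (1 - y a) * v l = 1) ->
  diag (3 * m.+1) - offdiag (3 * m.+1) =
  \prod_(0 <= a < m.+1) (1 - z a) * \prod_(0 <= a < m.+1) (1 - y a) * (1 - x 0%N)
  * (1 - \sum_(1 <= l < m.+1) x l * \prod_(1 <= b < l) (1 - x b) * v l).
Proof.
move=> vK; rewrite letter_diag // letter_offdiag // subnn big_split /=.
rewrite [\sum_(0 <= l < _) _]big_ltn // [\prod_(0 <= b < 0) _]big_geq // mulr1.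
have -> : \sum_(1 <= l < m.+1) x l * \prod_(l <= a < m.+1) (1 - y a)
                                      * \prod_(0 <= b < l) (1 - x b)
  = \prod_(0 <= a < m.+1) (1 - y a) * (1 - x 0%N) *
    \sum_(1 <= l < m.+1) x l * \prod_(1 <= b < l) (1 - x b) * v l.
  rewrite mulr_sumr; apply: eq_big_nat => l /andP[lt0l lt_lm].
  rewrite [\prod_(0 <= a < m.+1) _](big_cat_nat (n := l)) //=; last exact: ltnW.
  rewrite [\prod_(0 <= b < l) (1 - x b)]big_ltn //.
  by rewrite -[LHS]mulr1 -[X in _ * X = _](vK l); ring.
by ring.
Qed.

End LetterSystem.

Section LetterSeries.
Variables (R : comNzRingType) (m : nat) (x y z : nat -> R).
Let K := (3 * m.+1)%N.
Let ux j : fps R := fps_mono (x j).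
Let uy j : fps R := fps_mono (y j).
Let uz j : fps R := fps_mono (z j).

Lemma fps_mono_letter l : fps_mono (letter_val m x y z l) = letter_val m ux uy uz l.
Proof. by rewrite /letter_val; case: ifP => // _; case: ifP. Qed.

(** The loop factors of all [y] letters and of [x 0] cancel against the determinant; those of [x j]
    with [j >= 1] survive as the numerator. *)
Lemma letter_edge_series :
  edge_series (kind_entry (fun l : 'I_K => letter_kind l) (letter_val m x y z))
    (moving_letters (fun l : 'I_K => letter_kind l))
  = \prod_(1 <= j < m.+1) fps_lin (x j) * fps_inv (\prod_(0 <= j < m.+1) fps_lin (z j))
    * fps_inv (1 - \sum_(1 <= l < m.+1) fps_mono (x l) *
         \prod_(1 <= j < l) fps_lin (x j) * fps_inv (\prod_(0 <= j < l) fps_lin (y j))).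
Proof.
set kind := fun l : 'I_K => letter_kind l; set B := kind_entry _ _.
rewrite edge_seriesE; last by rewrite filter_uniq ?enum_uniq.
have -> : \prod_(b <- moving_letters kind) (1 - fps_mono (B b b)) =
    \prod_(0 <= a < m.+1) (1 - uy a) * \prod_(0 <= a < m.+1) (1 - ux a).
  have := @letter_moving _ m ux uy uz m.+1 (leqnn _); rewrite subnn => <-.
  rewrite big_filter big_enum_cond big_mkord; apply: eq_big => // b kb.
  by rewrite -fps_mono_letter /B /kind_entry /row_allows leqnn eqxx !if_same mul1r.
pose w := letter_val m x y z.
pose before := letter_before m x y z.
pose after := letter_after m x y z.
have -> : balanced B K =
    balanced (fun a b : 'I_K => split_entry before w after a b) K.
  congr (balanced _ K); apply/funext => a; apply/funext => b.
  rewrite /B /kind_entry /row_allows /split_entry /before /after /letter_before /letter_after.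
  rewrite -/w /kind.
  have : (letter_kind b < 3)%N by rewrite ltn_mod.
  case: (letter_kind b) => [|[|[|//]]] _ /=.
  - by case: (ltngtP b a) => _; rewrite ?mul1r ?mul0r.
  - rewrite [a == b]eq_sym -val_eqE /=.
    by case: (ltngtP b a) => _; rewrite ?mul1r ?mul0r.
  - by case: (ltngtP b a) => _; rewrite ?mul1r ?mul0r.
set bal := balanced _ K.
have := balanced_split before w after (leqnn K); rewrite -/bal.
have beforeE : (fun l => fps_mono (before l)) = letter_before m ux uy uz.
  apply/funext => l; rewrite /before /letter_before -fps_mono_letter.
  by case: ifP => // _; rewrite /fps_mono mul0r.
have afterE : (fun l => fps_mono (after l)) = letter_after m ux uy uz.
  apply/funext => l; rewrite /after /letter_after -fps_mono_letter.
  by case: ifP => // _; rewrite /fps_mono mul0r.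
have wE : (fun l => fps_mono (w l)) = letter_val m ux uy uz.
  by apply/funext => l; rewrite fps_mono_letter.
rewrite beforeE afterE wE.
pose v l := fps_inv (\prod_(0 <= a < l) (1 - uy a)).
have inv1 (f : fps R) : f 0%N = 1 -> f * fps_inv f = 1 by exact: fps_mulV.
have prod1 (a b : nat) (F : nat -> R) : (\prod_(a <= j < b) fps_lin (F j)) 0%N = 1.
  by apply: fps_prod0 => j; exact: fps_lin0.
rewrite (@letter_systemE _ m ux uy uz v); last by move=> l; apply/inv1/prod1.
set N := \prod_(1 <= a < m.+1) (1 - ux a).
set Q := \sum_(1 <= l < m.+1) _; set Dz := \prod_(0 <= a < m.+1) (1 - uz a).
set Dy := \prod_(0 <= a < m.+1) (1 - uy a) => balK.
have DzK : Dz * fps_inv Dz = 1 by apply/inv1/prod1.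
have Q0 : (1 - Q) 0%N = 1.
  rewrite /Q coef_fpsD coef_fpsN coef_fps_sum big1 ?subr0 // => l _.
  by rewrite -mulrA coef_mono_mul0.
have QK := inv1 _ Q0.
rewrite [\prod_(0 <= a < m.+1) (1 - ux a)]big_ltn // -/N; symmetry.
(* The determinant times [bal] is 1, so inserting this product in the target avoids inverting
   [bal]. *)
transitivity (N * fps_inv Dz * fps_inv (1 - Q) *
    (Dz * Dy * (1 - ux 0%N) * (1 - Q) * bal)); first by rewrite balK mulr1.
transitivity (Dy * ((1 - ux 0%N) * N) * bal * (Dz * fps_inv Dz) * ((1 - Q) * fps_inv (1 - Q))).
  by ring.
by rewrite DzK QK !mulr1.
Qed.

End LetterSeries.

Definition letter_weight m (l : nat) : Rm m :=
  letter_val m (Xv m) (Yv m) (fun j => (var_r)%:MP * Zv m j) l.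

Lemma Sm_edge_series m (kind := fun l : 'I_(3 * m.+1) => letter_kind l) :
  Sm m = edge_series (kind_entry kind (letter_weight m)) (moving_letters kind).
Proof. by rewrite letter_edge_series. Qed.

(** * Effective indices and crossing descents *)

Section Rho.
Variable m : nat.
Implicit Types p q : Rm m.

(** Terms outside the support vanish; additivity needs both polynomials summed over a common
    list. *)
Lemma rho_widen (S : seq 'X_{1..nvar m}) p : uniq S -> {subset msupp p <= S} ->
  rho p = \sum_(M <- S) p@_M * var_s ^+ eff M.
Proof.
move=> uniq_S sub_S; rewrite (bigID (fun M => M \in msupp p)) /=.
rewrite [X in _ + X]big1 ?addr0 => [|M /memN_msupp_eq0 ->]; last by rewrite mul0r.
rewrite -big_filter; apply: perm_big; apply: uniq_perm => [||M].
- exact: msupp_uniq.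
- exact: filter_uniq.
by rewrite mem_filter andb_idr // => /sub_S.
Qed.

Lemma rhoD p q : rho (p + q) = rho p + rho q.
Proof.
set S := undup (msupp p ++ msupp q).
have uniq_S : uniq S by exact: undup_uniq.
rewrite (rho_widen uniq_S) => [|M /msuppD_le]; last by rewrite mem_undup mem_cat.
rewrite (@rho_widen S p) => [|//|M Mp]; last by rewrite mem_undup mem_cat Mp.
rewrite (@rho_widen S q) => [|//|M Mq]; last by rewrite mem_undup mem_cat Mq orbT.
by rewrite -big_split; apply: eq_bigr => M _; rewrite mcoeffD mulrDl.
Qed.

Lemma rho0 : rho (0 : Rm m) = 0. Proof. by rewrite /rho msupp0 big_nil. Qed.

Lemma rho_sum (I : Type) (s : seq I) (P : pred I) (F : I -> Rm m) :
  rho (\sum_(i <- s | P i) F i) = \sum_(i <- s | P i) rho (F i).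
Proof. exact: (big_morph _ rhoD rho0). Qed.

Lemma rho_monomial (c : Zsr) M : rho (c%:MP * 'X_[M] : Rm m) = c * var_s ^+ eff M.
Proof.
rewrite (@rho_widen [:: M]) // ?big_seq1 ?mcoeffCM ?mcoeffX ?eqxx ?mulr1 // => M'.
rewrite mcoeff_msupp mcoeffCM mcoeffX inE [M' == M]eq_sym.
by case: (M =P M') => // _; rewrite mulr0 eqxx.
Qed.

End Rho.

Section LetterMonomial.
Variables (n m : nat).
Let K := (3 * m.+1)%N.

Definition letter_idx (l : nat) : nat :=
  if letter_kind l == 0%N then Yidx m (letter_color m l)
  else if letter_kind l == 1%N then Zidx m (letter_color m l) else Xidx m (letter_color m l).

Definition word_monomial (c : 'I_n -> 'I_K) : 'X_{1..nvar m} :=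
  (\sum_(i < n) U_(inord (letter_idx (c i))))%MM.

Lemma prod_letter_weight (c : 'I_n -> 'I_K) :
  \prod_i letter_weight m (c i) =
  (var_r ^+ #|[pred i | letter_kind (c i) == 1%N]|)%:MP * 'X_[word_monomial c].
Proof.
rewrite (big_morph _ (@mpolyXD _ _) (@mpolyX0 _ _)) -prodr_const.
rewrite [X in X%:MP]big_mkcond rmorph_prod -big_split /=; apply: eq_bigr => i _.
rewrite /letter_weight /letter_val /letter_idx inE.
case: (letter_kind (c i)) => [|[|k]] /=; rewrite ?mul1r //.
Qed.

Variable c : 'I_n -> 'I_K.
Hypothesis mono_c : nondecreasing c.

Lemma word_mexp k : (k < nvar m)%N ->
  (0 < mexp (word_monomial c) k)%N = [exists i, letter_idx (c i) == k].
Proof.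
move=> lt_k; rewrite /mexp /word_monomial mnm_sumE lt0n sum_nat_eq0 negb_forall.
apply: eq_existsb => i; rewrite implyTb mnm1E eqb0 negbK -val_eqE /= !inordK //.
rewrite /letter_idx /letter_color /nvar /Yidx /Zidx /Xidx.
by case: ifP => _; last case: ifP => _; lia.
Qed.

Lemma word_hasX k : (k <= m)%N -> hasX (word_monomial c) k =
  [exists i, (letter_kind (c i) == 2) && (letter_color m (c i) == k)].
Proof.
move=> le_km; rewrite /hasX word_mexp; last by rewrite /nvar /Xidx; lia.
apply: eq_existsb => i; rewrite /letter_idx /letter_color /letter_kind /Yidx /Zidx /Xidx.
by have := ltn_ord (c i); rewrite /K; case: ifP; last (case: ifP); lia.
Qed.

Lemma word_hasYZ k : (k <= m)%N -> hasYZ (word_monomial c) k =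
  [exists i, (letter_kind (c i) != 2) && (letter_color m (c i) == k)].
Proof.
move=> le_km; rewrite /hasYZ !word_mexp; [|by rewrite /nvar /Zidx; lia|by rewrite /nvar /Yidx; lia].
apply/orP/existsP.
  rewrite /letter_idx /letter_color /letter_kind /Yidx /Zidx /Xidx.
  by case=> /existsP[i idx_i]; exists i; move: idx_i (ltn_ord (c i)); rewrite /K;
    (case: ifP => ?; last case: ifP => ?); lia.
case=> i /andP[ki /eqP ci]; case k0: (letter_kind (c i) == 0%N); [left|right];
  apply/existsP; exists i; rewrite /letter_idx k0 ci //.
suff -> : letter_kind (c i) == 1%N by [].
by move: ki k0 (ltn_mod (c i) 3); rewrite -/(letter_kind _); lia.
Qed.

(** A crossing descent read off the kinds: an excedance followed by a non-excedance. *)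
Definition crossing_pair (ij : 'I_n * 'I_n) : bool :=
  [&& val ij.2 == (val ij.1).+1, letter_kind (c ij.1) == 2 & letter_kind (c ij.2) != 2].

(** Along the positions colours weakly decrease, and inside a colour kinds weakly increase. If [j]
    is effective through [k], take the first position [i'] of colour [j] and its predecessor [i].
    Then [i'] is not an [X], as colour [j] contains a [Y] or [Z]; and [i] is an [X], its colour
    being either [k], after an [X], or strictly between [j] and [k]. Conversely, no position lies
    between [i] and [i'], so [k] can be the colour of [i]. *)
Lemma word_effective j : (j <= m)%N -> effective (word_monomial c) j =
  [exists ij, crossing_pair ij && (letter_color m (c ij.2) == j)].
Proof.
move=> le_jm; rewrite /effective word_hasYZ //; apply/andP/existsP.
  case=> /existsP[a /andP[ka ca]] /hasP[k].
  rewrite mem_iota add0n ltnS => /= le_km /andP[/andP[lt_jk]].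
  rewrite word_hasX // => /existsP[b /andP[kb cb]] /allP noYZ.
  have [i' /eqP ci' mini'] :=
    @arg_minnP _ a (fun i => letter_color m (c i) == j) val ca.
  have lt_bi : (b < i')%N.
    rewrite ltnNge; apply/negP => /mono_c; move: cb ci' (ltn_ord (c b)) (ltn_ord (c i')).
    by rewrite /letter_color /K; lia.
  have lt_in : (i'.-1 < n)%N by rewrite (leq_ltn_trans (leq_pred _)).
  pose i := Ordinal lt_in; have def_i' : val i' = i.+1 by rewrite /= prednK // (leq_trans _ lt_bi).
  have lt_ii' : (i < i')%N by rewrite def_i'.
  have le_bi : (b <= i)%N by rewrite -ltnS -def_i'.
  have ci : letter_color m (c i) != j.
    by apply: contraTN lt_ii' => /mini' /=; rewrite -leqNgt.
  have le_ia : (i' <= a)%N by exact: mini'.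
  have := mono_c le_bi; have := mono_c (ltnW lt_ii'); have := mono_c le_ia.
  move=> le1 le2 le3; exists (i, i'); rewrite /crossing_pair /= ci' eqxx andbT.
  apply/and3P; split; first by apply/eqP.
    case: (ltnP (letter_color m (c i)) k) => [lt_ck|ge_ck]; last first.
      move: ge_ck kb cb le3 (ltn_ord (c i)) (ltn_ord (c b)).
      by rewrite /letter_color /letter_kind /K; lia.
    have lt_jc : (j < letter_color m (c i))%N.
      by rewrite ltn_neqAle eq_sym ci -ci' /letter_color; lia.
    have le_cm : (letter_color m (c i) <= m)%N by rewrite leq_subr.
    have := noYZ (letter_color m (c i)); rewrite mem_iota subnKC //.
    rewrite lt_jc lt_ck => /(_ isT); rewrite word_hasYZ // negb_exists.
    by move=> /forallP/(_ i); rewrite eqxx andbT negbK.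
  move: ka ca ci' le1 (ltn_ord (c a)) (ltn_ord (c i')).
  by rewrite /letter_color /letter_kind /K; lia.
case=> -[i i']; rewrite /crossing_pair /= => /andP[/and3P[/eqP def_i' ki ki'] /eqP ci'].
have lt_ii' : (i < i')%N by rewrite def_i'.
have le1 := mono_c (ltnW lt_ii').
have le_cm : (letter_color m (c i) <= m)%N by rewrite leq_subr.
split; first by apply/existsP; exists i'; rewrite ki' ci' eqxx.
have lt_jc : (j < letter_color m (c i))%N.
  move: ki ki' ci' le1 (ltn_ord (c i)) (ltn_ord (c i')).
  by rewrite /letter_color /letter_kind /K; lia.
apply/hasP; exists (letter_color m (c i)); first by rewrite mem_iota; lia.
rewrite lt_jc word_hasX //=; apply/andP; split.
  by apply/existsP; exists i; rewrite ki eqxx.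
apply/allP => k; rewrite mem_iota subnKC // => /andP[lt_jk lt_kc].
have le_km : (k <= m)%N by apply: leq_trans le_cm; exact: ltnW.
rewrite word_hasYZ // negb_exists; apply/forallP => a; apply/negP => /andP[_ /eqP ca].
have lt_ia : (i < a)%N.
  rewrite ltnNge; apply/negP => /mono_c; move: ca lt_kc.
  by rewrite /letter_color; lia.
have : (i' <= a)%N by rewrite def_i'.
move=> /mono_c; move: ca lt_jk ci' (ltn_ord (c a)).
by rewrite /letter_color; lia.
Qed.

(** Each crossing pair is sent to the colour of its second position. Two pairs with the same image
    would put the [X] of the later pair before a [Y] or [Z] of its own colour. *)
Lemma eff_crossing : eff (word_monomial c) = #|crossing_pair|.
Proof.
pose f (ij : 'I_n * 'I_n) : 'I_m.+1 := inord (letter_color m (c ij.2)).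
have fE ij : f ij = letter_color m (c ij.2) :> nat by rewrite inordK // ltnS leq_subr.
rewrite /eff -sum1_count -[iota 0 _]/(index_iota 0 m.+1) big_mkord sum1_card.
have -> : #|crossing_pair| = #|[set f ij | ij in crossing_pair]|.
  rewrite card_in_imset // => -[i1 j1] [i2 j2]; rewrite !unfold_in /crossing_pair /=.
  wlog le_i : i1 j1 i2 j2 / (i1 <= i2)%N => [wlog_le|].
    case/orP: (leq_total i1 i2) => le_i h1 h2 eq_f; first exact: wlog_le.
    by apply/esym/wlog_le.
  move=> /and3P[/eqP def_j1 k1 k1'] /and3P[/eqP def_j2 k2 k2'].
  move=> /(congr1 (@nat_of_ord _)); rewrite !fE /= => eq_col.
  have eq_i : i1 = i2.
    apply/val_inj/eqP; rewrite eqn_leq le_i leqNgt; apply/negP => lt_i.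
    have le_j1 : (j1 <= i2)%N by rewrite def_j1.
    have le_j2 : (i2 <= j2)%N by rewrite def_j2.
    have := mono_c le_j1; have := mono_c le_j2; move: k2 k2' eq_col.
    move: (ltn_ord (c j1)) (ltn_ord (c i2)) (ltn_ord (c j2)).
    by rewrite /letter_color /letter_kind /K; lia.
  by congr (_, _) => //; apply/val_inj; rewrite /= def_j1 def_j2 eq_i.
apply: eq_card => j; transitivity (effective (word_monomial c) j) => //.
rewrite word_effective; last by rewrite -ltnS.
apply/existsP/imsetP => [[ij /andP[cross_ij /eqP col]]|[ij cross_ij ->]].
  by exists ij => //; apply/val_inj; rewrite /= fE.
by exists ij; rewrite fE eqxx andbT.
Qed.

Lemma kind_match_xdes (s : 'S_n) : kind_match (fun l : 'I_K => letter_kind l) c s ->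
  xdes s = #|crossing_pair|.
Proof.
move=> /forallP match_s; apply: eq_card => -[i j]; rewrite !unfold_in /=.
rewrite /crossing_pair /=; case: eqP => //= def_j.
have := match_s i; have := match_s j; rewrite /kind_rel.
have := ltn_mod (c i) 3; have := ltn_mod (c j) 3; rewrite -/(letter_kind _) -/(letter_kind _).
have ne : (s i : nat) <> s j.
  by move=> /val_inj/perm_inj eq_ij; move: def_j; rewrite eq_ij; lia.
by move: def_j ne; rewrite /=; do ?case: ifP => ?; lia.
Qed.

Lemma kind_match_fixp (s : 'S_n) : kind_match (fun l : 'I_K => letter_kind l) c s ->
  fixp s = #|[pred i | letter_kind (c i) == 1%N]|.
Proof.
move=> /forallP match_s; apply: eq_card => i; rewrite !unfold_in /=.
have := match_s i; rewrite /kind_rel -val_eqE /=.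
case: (letter_kind (c i)) => [|[|k]] /= h; rewrite ?h //; lia.
Qed.

End LetterMonomial.

(** On a compatible pair the image of the weight under [rho] depends on [s] alone, so the sum over
    words leaves a multiplicity. *)
Lemma RHSserE n m (kind := fun l : 'I_(3 * m.+1) => letter_kind l) :
  RHSser n m = \sum_(s : 'S_n) (var_s ^+ xdes s * var_r ^+ fixp s) *+
    #|[set t in basis (3 * m.+1) n | block_increasing (tnth t) s &&
                                      kind_match kind (tnth t) s]|.
Proof.
rewrite /RHSser Sm_edge_series -sum_compatible_pairs rho_sum.
transitivity (\sum_(t in basis (3 * m.+1) n)
    \sum_(s : 'S_n | block_increasing (tnth t) s && kind_match kind (tnth t) s)
       var_s ^+ xdes s * var_r ^+ fixp s).
  apply: eq_bigr => t t_basis; rewrite rho_sum; apply: eq_bigr => s /andP[_ match_s].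
  rewrite prod_letter_weight rho_monomial eff_crossing; last exact: basis_nondecreasing.
  by rewrite -(kind_match_xdes match_s) -(kind_match_fixp match_s) mulrC.
rewrite (exchange_big_dep xpredT) //=; apply: eq_bigr => s _.
rewrite -sumr_const; apply: eq_bigl => t; by rewrite !inE.
Qed.

(** * Counting colour sequences *)

Section CompatibleCount.
Variables (m n : nat) (s : 'S_n.+1).
Let K := (3 * m.+1)%N.
Let kind (l : 'I_K) := letter_kind l.

Let S k : nat := s (inord k : 'I_n.+1).
Definition descent_at k : bool := (S k.+1 < S k)%N.
Definition descents_before k : nat := \sum_(0 <= j < k) descent_at j.

Let valS (i : 'I_n.+1) : S i = s i. Proof. by rewrite /S inord_val. Qed.

Let S_inj k l : (k <= n)%N -> (l <= n)%N -> S k = S l -> k = l.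
Proof.
move=> le_kn le_ln /val_inj/perm_inj/(congr1 val) /=.
by rewrite !inordK.
Qed.

Lemma descents_beforeS k : descents_before k.+1 = (descents_before k + descent_at k)%N.
Proof. by rewrite /descents_before big_nat_recr. Qed.

Lemma descents_before_le k : (descents_before k <= k)%N.
Proof.
elim: k => [|k IHk]; first by rewrite /descents_before big_geq.
by rewrite descents_beforeS -addn1 leq_add // leq_b1.
Qed.

Lemma descents_before_mono k l : (k <= l)%N -> (descents_before k <= descents_before l)%N.
Proof.
by move=> le_kl; rewrite [descents_before l](big_cat_nat (n := k)) //= leq_addr.
Qed.

Lemma desE : des s = descents_before n.
Proof.
rewrite /des /descents_before -sum1_card big_mkcond /=.
pose P (i j : 'I_n.+1) := (val j == (val i).+1) && (s j < s i)%N.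
transitivity (\sum_(i < n.+1) \sum_(j < n.+1) P i j)%N.
  rewrite pair_big /=; apply: eq_bigr => -[i j] _; rewrite inE /=.
  by rewrite -[_ && _]/(P i j); case: (P i j).
rewrite big_ord_recr /= [X in (_ + X)%N]big1 ?addn0 => [|j _]; last first.
  by rewrite /P /= ltn_eqF.
rewrite big_mkord; apply: eq_bigr => i _.
have lt_i : (i.+1 < n.+1)%N by rewrite ltnS.
rewrite (bigD1 (Ordinal lt_i)) //= big1 ?addn0 => [|j neq_j].
  by rewrite /P /= eqxx /descent_at -!valS.
rewrite /P /=; case: eqP => // def_j; case/eqP: neq_j; exact: val_inj.
Qed.

Definition compatible_words : {set n.+1.-tuple 'I_K} :=
  [set t in basis K n.+1 | block_increasing (tnth t) s && kind_match kind (tnth t) s].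

Let entry (t : n.+1.-tuple 'I_K) k : nat := tnth t (inord k).

Let entry_lt t k : (entry t k < 3 * m.+1)%N. Proof. exact: ltn_ord. Qed.

Let kind_at k : nat := if (S k < k)%N then 0 else if S k == k then 1 else 2.

(** The kinds are dictated by [s]. Between adjacent positions of equal colour an ascent of [s] makes
    the kind weakly increase and a descent makes it weakly decrease, so all order conditions reduce
    to colours. *)
Lemma compatible_wordsP (t : n.+1.-tuple 'I_K) :
  reflect ((forall k, (k <= n)%N -> letter_kind (entry t k) = kind_at k) /\
           (forall k, (k < n)%N ->
              (entry t k %/ 3 + descent_at k <= entry t k.+1 %/ 3)%N))
          (t \in compatible_words).
Proof.
have entryE (i : 'I_n.+1) : entry t i = tnth t i by rewrite /entry inord_val.
have kindE : kind_match kind (tnth t) s <->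
    (forall k, (k <= n)%N -> letter_kind (entry t k) = kind_at k).
  rewrite /kind_match; split=> [/forallP match_s k le_kn|kinds].
    have := match_s (inord k); rewrite -/(entry t k) -/(S k) inordK // /kind.
    have := ltn_mod (entry t k) 3; rewrite -/(letter_kind _) /kind_rel /kind_at.
    by rewrite -/(entry t k); do ?case: ifP => ?; lia.
  apply/forallP => i; have := kinds i (ltn_ord i); rewrite entryE /kind_at valS /kind => ->.
  by rewrite /kind_rel; case: ltngtP.
have stepE k : (k < n)%N -> letter_kind (entry t k) = kind_at k ->
    letter_kind (entry t k.+1) = kind_at k.+1 ->
    ((entry t k <= entry t k.+1)%N && ((entry t k == entry t k.+1) ==> (S k < S k.+1)%N))
    = (entry t k %/ 3 + descent_at k <= entry t k.+1 %/ 3)%N.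
  move=> lt_kn; have : S k <> S k.+1 by move/S_inj => eq_k; have := eq_k (ltnW lt_kn) lt_kn; lia.
  rewrite /letter_kind /kind_at /descent_at.
  by do ?case: ifP => ?; case: eqP => ?; lia.
rewrite inE; apply: (iffP and3P).
  case=> t_basis /block_increasingP incr /kindE kinds; split=> // k lt_kn.
  rewrite -stepE ?kinds //; last exact: ltnW.
  have lt_k : ((inord k : 'I_n.+1) < (inord k.+1 : 'I_n.+1))%N.
    by rewrite !inordK ?ltnS //; exact: ltnW.
  rewrite /entry (basis_nondecreasing t_basis) ?(ltnW lt_k) //=.
  by apply/implyP => /eqP/val_inj; exact: incr.
case=> kinds steps.
have adj k : (k < n)%N -> (entry t k <= entry t k.+1)%N /\
    (entry t k = entry t k.+1 -> (S k < S k.+1)%N).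
  move=> lt_kn; have := steps k lt_kn; rewrite -stepE ?kinds //; last exact: ltnW.
  by case/andP => le_e /implyP incr; split=> // /eqP.
have mono k l : (k <= l <= n)%N -> (entry t k <= entry t l)%N.
  elim: l => [|l IHl] /andP[le_kl le_ln]; first by move: le_kl; rewrite leqn0 => /eqP->.
  move: le_kl; rewrite leq_eqVlt => /predU1P[-> //|le_kl].
  by apply: leq_trans (proj1 (adj l le_ln)); apply: IHl; lia.
have incr k l : (k < l <= n)%N -> entry t k = entry t l -> (S k < S l)%N.
  elim: l => [|l IHl] /andP[le_kl le_ln] // eq_e.
  have le1 : (entry t k <= entry t l)%N by apply: mono; lia.
  have [le2 incr_l] := adj l le_ln.
  have eq_l : entry t k = entry t l by lia.
  have {}incr_l : (S l < S l.+1)%N by apply: incr_l; lia.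
  move: le_kl; rewrite ltnS leq_eqVlt => /predU1P[->//|lt_kl].
  by apply: ltn_trans incr_l; apply: IHl => //; lia.
split; last exact/kindE.
  rewrite inE; apply/(sortedP 0%N) => k; rewrite size_map size_tuple ltnS => lt_kn.
  have nthE l : (l <= n)%N -> nth 0%N [seq val i | i <- t] l = entry t l.
    move=> le_l; rewrite (nth_map (tnth t ord0)) ?size_tuple //.
    by rewrite /entry (tnth_nth (tnth t ord0) t (inord l)) inordK.
  by rewrite !nthE ?(ltnW lt_kn) //; case: (adj k lt_kn).
apply/block_increasingP => i j lt_ij /(congr1 val) /= eq_t.
rewrite -!valS; apply: incr; first by rewrite lt_ij -ltnS ltn_ord.
by rewrite !entryE.
Qed.

(* The difference of colours loses one unit at each descent; adding the number
   of earlier non-descents makes the sequence strictly increasing. *)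
Lemma card_compatible_words : #|compatible_words| = 'C(m + n.+1 - des s, n.+1).
Proof.
have le_Dn := descents_before_le n.
have -> : (m + n.+1 - des s = (m + n - descents_before n).+1)%N by rewrite desE; lia.
rewrite -card_ltn_sorted_tuples; set N := (m + n - descents_before n)%N.
(* The quotient [entry t k %/ 3] is [m] minus the colour, hence at most [m]; so the last and largest
   value [e t n] is at most [N]. *)
pose e (t : n.+1.-tuple 'I_K) k := (entry t k %/ 3 + k - descents_before k)%N.
pose h (t : n.+1.-tuple 'I_K) : n.+1.-tuple 'I_N.+1 := [tuple inord (e t i) | i < n.+1].
have e_step t : t \in compatible_words -> forall k, (k < n)%N -> (e t k < e t k.+1)%N.
  case/compatible_wordsP => _ steps k lt_kn; have := steps k lt_kn.
  rewrite /e descents_beforeS; have := descents_before_le k.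
  by case: (descent_at k); lia.
have homo_step (f : nat -> nat) : (forall k, (k < n)%N -> (f k < f k.+1)%N) ->
    forall k l, (k <= l <= n)%N -> (f k + (l - k) <= f l)%N.
  move=> fS k; elim=> [|l IHl] /andP[le_kl le_ln].
    by move: le_kl; rewrite leqn0 => /eqP->; rewrite addn0.
  move: le_kl; rewrite leq_eqVlt => /predU1P[->|le_kl]; first by rewrite subnn addn0.
  have {}IHl : (f k + (l - k) <= f l)%N by apply: IHl; lia.
  by have := fS l le_ln; lia.
have e_bound t : t \in compatible_words -> forall k, (k <= n)%N -> (e t k < N.+1)%N.
  move=> t_compat k le_kn.
  have := homo_step _ (e_step t t_compat) k n; rewrite le_kn leqnn => /(_ isT).
  have : (entry t n %/ 3 <= m)%N by have := entry_lt t n; lia.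
  by rewrite /N /e; lia.
have hE t i : t \in compatible_words -> tnth (h t) i = e t i :> nat.
  by move=> t_compat; rewrite tnth_mktuple inordK // e_bound // -ltnS.
rewrite -(card_in_imset (f := h)); last first.
  move=> t1 t2 compat1 compat2 eq_h; apply: eq_from_tnth => i; apply: val_inj => /=.
  have := congr1 (fun t => val (tnth t i)) eq_h; rewrite /= !hE // /e => eq_e.
  have [/compatible_wordsP[kinds1 _] /compatible_wordsP[kinds2 _]] := (compat1, compat2).
  have le_in : (i <= n)%N by rewrite -ltnS.
  suff : entry t1 i = entry t2 i by rewrite /entry inord_val.
  move: (kinds1 i le_in); rewrite -(kinds2 i le_in) /letter_kind.
  by have := descents_before_le i; move: eq_e; lia.
apply: eq_card => u; rewrite [RHS]inE; apply/imsetP/idP => [[t t_compat ->]|sorted_u].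
  apply/(sortedP 0%N) => k; rewrite size_map size_tuple ltnS => lt_kn.
  have nthE l : (l <= n)%N -> nth 0%N [seq val i | i <- h t] l = e t l.
    move=> le_l; rewrite (nth_map ord0) ?size_tuple //.
    have -> : nth ord0 (h t) l = tnth (h t) (inord l) by rewrite (tnth_nth ord0) inordK.
    by rewrite /= hE // inordK.
  by rewrite !nthE ?(ltnW lt_kn) //; exact: e_step.
pose E k : nat := tnth u (inord k).
have E_step k : (k < n)%N -> (E k < E k.+1)%N.
  move=> lt_kn; have /(sortedP 0%N)/(_ k) := sorted_u.
  rewrite size_map size_tuple ltnS => /(_ lt_kn).
  have nthE l : (l <= n)%N -> nth 0%N [seq val i | i <- u] l = E l.
    by move=> le_l; rewrite (nth_map ord0) ?size_tuple // /E (tnth_nth ord0) inordK.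
  by rewrite !nthE // ltnW.
have E_ge k : (k <= n)%N -> (k <= E k)%N.
  by move=> le_kn; have := homo_step E E_step 0%N k; rewrite le_kn => /(_ isT); lia.
have E_le k : (k <= n)%N -> (E k + descents_before k - k <= m)%N.
  move=> le_kn; have := homo_step E E_step k n; rewrite le_kn leqnn => /(_ isT).
  have := ltn_ord (tnth u (inord n)); rewrite -/(E n) /N.
  by have := descents_before_mono le_kn; lia.
(* The inverse map: the quotient is recovered from [E] and the remainder from [s]. Since [k <= E k],
   the truncated subtraction is exact. *)
pose T k := (3 * (E k + descents_before k - k) + kind_at k)%N.
have kind3 k : (kind_at k < 3)%N by rewrite /kind_at; case: ifP => // _; case: ifP.
have T_lt k : (k <= n)%N -> (T k < K)%N.
  by move=> /E_le le_m; have := kind3 k; rewrite /T /K; lia.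
pose t : n.+1.-tuple 'I_K := [tuple Ordinal (T_lt i (ltn_ord i)) | i < n.+1].
have entryE k : (k <= n)%N -> entry t k = T k.
  by move=> le_kn; rewrite /entry tnth_mktuple /= inordK.
have t_compat : t \in compatible_words.
  apply/compatible_wordsP; split=> k lt_kn.
    by rewrite entryE // /letter_kind /T; have := kind3 k; lia.
  rewrite !entryE ?(ltnW lt_kn) // /T descents_beforeS.
  have := E_step k lt_kn; have := E_ge k (ltnW lt_kn); have := E_ge k.+1 lt_kn.
  have := kind3 k; have := kind3 k.+1; have := descents_before_le k.
  by case: (descent_at k); lia.
exists t => //; apply: eq_from_tnth => i; apply: val_inj; rewrite /= hE //.
have le_in : (i <= n)%N by rewrite -ltnS.
rewrite /e entryE // /T; have := kind3 i; have := E_ge i le_in; have := descents_before_le i.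
have <- : E i = tnth u i by rewrite /E inord_val.
by lia.
Qed.

End CompatibleCount.

(** * Binomial expansion of [F] *)

Lemma fps_inv_binomial (R : comNzRingType) n k :
  fps_inv (fps_pow (fps_lin (1 : R)) n.+1) k = 'C(n + k, n)%:R.
Proof.
rewrite fps_powE; pose B n : fps R := fun k => 'C(n + k, n)%:R.
(* By Pascal's rule, multiplying [B n.+1] by [fps_lin 1] gives [B n]. *)
have lin1 : fps_lin (1 : R) ^+ n.+1 * B n = 1.
  elim: n => [|n IHn].
    apply/funext => -[|j]; rewrite expr1 fps_linE mulrBl mul1r coef_fpsD coef_fpsN.
      by rewrite coef_mono_mul0 /B bin0 subr0.
    by rewrite coef_mono_mulS /B !bin0 mulr1 subrr.
  rewrite exprS -mulrA mulrCA -[RHS]IHn; congr (_ * _).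
  apply/funext => -[|j]; rewrite fps_linE mulrBl mul1r coef_fpsD coef_fpsN.
    by rewrite coef_mono_mul0 /B !addn0 !binn subr0.
  rewrite coef_mono_mulS mul1r /B [(n.+1 + j.+1)%N]addnS binS natrD.
  by rewrite addrAC subrr add0r addSnnS.
have lin0 : (fps_lin (1 : R) ^+ n.+1) 0%N = 1.
  elim: n.+1 => [|k' IHk]; first by rewrite expr0.
  by rewrite exprS fps_mulr0 fps_lin0 IHk mulr1.
suff -> : fps_inv (fps_lin (1 : R) ^+ n.+1) = B n by [].
by rewrite -[LHS]mulr1 -[X in _ * X = _]lin1 mulrCA mulrA fps_mulV // mul1r.
Qed.

Lemma des_ord0 (s : 'S_0) : des s = 0%N.
Proof. by apply: eq_card0 => -[[]]. Qed.

Lemma FserE n m : Fser n m =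
  \sum_(s : 'S_n) (var_s ^+ xdes s * var_r ^+ fixp s) *+ 'C(m + n - des s, n).
Proof.
rewrite /Fser /fps_mul /Apoly.
under eq_bigr => i _ do rewrite fps_inv_binomial big_distrl big_mkcond /=.
rewrite exchange_big /=; apply: eq_bigr => s _.
case: (ltnP (des s) m.+1) => [le_d|lt_d].
  rewrite (bigD1 (Ordinal le_d)) //= eqxx big1 ?addr0 => [|i neq_i].
    by rewrite mulr_natr addnBA // addnC.
  by case: eqP => // def_i; case/eqP: neq_i; apply: val_inj.
(* For [des s > m] the sum has no term, and the binomial vanishes since [m + n - des s < n] when
   [n > 0]; for [n = 0] there are no descents. *)
rewrite big1 => [|i _]; last by rewrite gtn_eqF // (leq_trans (ltn_ord i)).
rewrite bin_small ?mulr0n //; case: n s lt_d => [|n] s lt_d; last by lia.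
by rewrite des_ord0 in lt_d.
Qed.

(* Equality of formal power series in t and u, coefficientwise:
   for all n, m, [u^n t^m] F(t,s,r;u) = [u^n t^m] sum_m t^m rho(S_m(u)). *)
Theorem theorem3p3 : forall n m : nat, Fser n m = RHSser n m.
Proof.
move=> n m; rewrite FserE RHSserE; apply: eq_bigr => s _; congr (_ *+ _).
(* The words were counted for positive length; in length 0 the empty word is the only one. *)
case: n s => [|n] s; last by rewrite -card_compatible_words.
rewrite bin0; apply/esym/eqP/cards1P; exists [tuple]; apply/setP => t.
rewrite !inE tuple0 eqxx; apply/and3P; split=> //.
- by apply/block_increasingP => -[].
- by apply/forallP => -[].
Qed.
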